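(* Assume $\mathring\Phi$ is simply laced, let $\ell$ be a positive integer, and put $e=\ell$ if $\ell$ is odd and $e=\ell/2$ if $\ell$ is even. Let $\lambda_0\in\mathcal C^-_{\rm rat}$ have level $\lambda_0(c)=k$ with $-(k+g)=\ell/2$, and let $\phi_\ell:W_e\to W(\lambda_0)$ be the isomorphism described in the context. For $y,w\in W_e$, $y\le_e w$ if and only if $\phi_\ell(y)\le'\phi_\ell(w)$. Also: (a) If $\lambda\in C$ is a dominant weight, and $y,w\in W_e$ are minimal with $y\cdot\lambda$, $w\cdot\lambda$ dominant, then $y\le_e w$ if and only if $y\cdot\lambda\uparrow_e w\cdot\lambda$. (b) In the affine case, let $\lambda\in\mathcal C^-_{\rm rat}$ and let $\mu,\nu\in[\lambda]$. Write $\mu=y\cdot\lambda$ and $\nu=w\cdot\lambda$, with $y':=w_0yw_0$ and $w':=w_0ww_0$ both minimal with respect to $\le'$ (or, equivalently, $y,w\in W(\lambda)$ are minimal with respect to $\le$ among elements sending $\lambda$ to $\mu$, resp. $\nu$). Then $y'\le'w'$ if and only if $\mu\uparrow\nu$; also equivalent is $y\le w$.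
   Context: Finite notation. $\mathring\Phi$ is the (simply laced irreducible) root system of a complex simple Lie algebra $\mathring{\mathfrak g}$ with Cartan subalgebra $\mathring{\mathfrak h}$, positive roots $\mathring\Phi^+$, simple roots $\alpha_1,\dots,\alpha_r$, maximal root $\theta$, root lattice $\mathring Q$, weight lattice $\mathring P$, Weyl group $\mathring W$ with longest element $w_0$, half-sum of positive roots $\mathring\rho$, dual Coxeter number $g$, form normalized by $(\theta,\theta)=2$. $W_e=\mathring W\ltimes e\mathring Q$ acts on $\mathbb R\mathring P$ by the dot action $w\cdot x=w(x+\mathring\rho)-\mathring\rho$ ($w\in\mathring W$) and translations by $e\mathring Q$. $C=\{x\in\mathbb R\mathring P:0<\langle x+\mathring\rho,\alpha^\vee\rangle<e\ \forall\alpha\in\mathring\Phi^+\}$; $\le_e$ is the Bruhat-Chevalley order on $W_e$ with respect to the generating reflections in the walls of $C$. For $\mu,\nu\in\mathring P$, $\mu\uparrow_e\nu$ means $\mu=\nu$ or there are $\mu=\mu_0\le\mu_1\le\cdots\le\mu_m=\nu$ in $\mathring P$ (dominance order) and reflections $s_i\in W_e$ with $s_i\cdot\mu_{i-1}=\mu_i$. Affine notation. $\mathfrak g=(\mathbb C[t,t^{-1}]\otimes\mathring{\mathfrak g})\oplus\mathbb Cc\oplus\mathbb Cd$, $\mathfrak h=\mathring{\mathfrak h}\oplus\mathbb Cc\oplus\mathbb Cd$, $\mathfrak h^*=\mathring{\mathfrak h}^*\oplus\mathbb C\chi\oplus\mathbb C\delta$, $\chi(c)=\delta(d)=1$, other values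 zero; real roots $j\delta+\beta$ ($j\in\mathbb Z$, $\beta\in\mathring\Phi$), positive if $j>0$ or $j=0,\beta>0$, $(j\delta+\beta)^\vee=\beta^\vee+jc$; $\alpha_0=\delta-\theta$; $\mu\le\nu$ on $\mathfrak h^*$ means $\nu-\mu\in\sum_{i=0}^r\mathbb N\alpha_i$; $\rho=\mathring\rho+g\chi$; $s_\alpha(x)=x-\langle x,\alpha^\vee\rangle\alpha$; $w\cdot x=w(x+\rho)-\rho$. For $\lambda\in\mathfrak h^*$, $\Phi(\lambda)$ is the set of real roots with $\langle\lambda+\rho,\alpha^\vee\rangle\in\mathbb Z$, $\Phi^+(\lambda)$ its positive part, $W(\lambda)=\langle s_\alpha:\alpha\in\Phi(\lambda)\rangle$, a Coxeter group with simple reflections those $s_\alpha$, $\alpha\in\Phi^+(\lambda)$, with $s_\alpha(\Phi^+(\lambda)\setminus\{\alpha\})=\Phi^+(\lambda)\setminus\{\alpha\}$; $\le$ is its Bruhat-Chevalley order. $\mathcal C^-$ is the set of $\lambda$ with $\langle\lambda+\rho,c\rangle\ne0$ and $\langle\lambda+\rho,\alpha^\vee\rangle\le0$ for all $\alpha\in\Phi^+(\lambda)$; $\mathcal C^-_{\rm rat}$ consists of those with in addition $\langle\lambda,\alpha_i^\vee\rangle\in\mathbb Z$ for $1\le i\le r$ and $\lambda(c)\in\mathbb Q$; $[\lambda]=W(\lambda)\cdot\lambda$. For $y,w\in W(\lambda)$ ($\lambda\in\mathcal C^-_{\rm rat}$), $y\le'w$ means $w_0yw_0\le w_0ww_0$.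 $\nu\uparrow\mu$ means $\nu=\mu$ or there are positive real roots $\beta_1,\dots,\beta_m$ with $\nu=s_{\beta_m}\cdots s_{\beta_1}\cdot\mu\le\cdots\le s_{\beta_1}\cdot\mu\le\mu$. $\phi_\ell:W_e\to W(\lambda_0)$ is the group isomorphism sending the reflection in the hyperplane $\{x:\langle x+\mathring\rho,\alpha_i^\vee\rangle=0\}$ to $s_{\alpha_i}$ ($1\le i\le r$), and the reflection in $\{x:\langle x+\mathring\rho,\theta^\vee\rangle=-e\}$ to $s_{2\delta-\theta}$ if $\ell$ is odd and to $s_{\delta-\theta}$ if $\ell$ is even. *)

(* Defs.v *)
From mathcomp Require Import all_boot all_order all_algebra.
From mathcomp Require Import finmap complex.
From mathcomp Require Import boolp classical_sets functions reals.

Set Implicit Arguments.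
Unset Strict Implicit.
Unset Printing Implicit Defensive.

Import Order.TTheory GRing.Theory Num.Theory.

Local Open Scope classical_set_scope.
Local Open Scope ring_scope.

(* Groups of transformations of a type T are sets of functions T -> T under
   composition.  The generating sets S used below are stable under inversion,
   so the group generated by S is the set of all finite products from S. *)
Section ReflectionGroups.
Variable T : Type.
Implicit Types (S : set (T -> T)) (s t w x y : T -> T) (m n : nat).

Inductive is_word S : nat -> (T -> T) -> Prop :=
| word_nil : is_word S 0 id
| word_cons n s w : S s -> is_word S n w -> is_word S n.+1 (s \o w).

Definition generated S : set (T -> T) := [set w | exists n, is_word S n w].

Definition has_length S w n :=
  is_word S n w /\ forall m, is_word S m w -> (n <= m)%N.

(* Reflections in the Coxeter-theoretic sense: conjugates u s u^-1, s \in S. *)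
Definition cox_reflection S : set (T -> T) :=
  [set t | exists u v s, [/\ generated S u, generated S v, S s,
     u \o v = id & t = u \o s \o v]].

Inductive bruhat S : (T -> T) -> (T -> T) -> Prop :=
| bruhat_refl w : generated S w -> bruhat S w w
| bruhat_step y x t m n :
    bruhat S y x -> cox_reflection S t ->
    has_length S x m -> has_length S (x \o t) n -> (m < n)%N ->
    bruhat S y (x \o t).

Definition longest S w :=
  generated S w /\
  forall u m n, generated S u -> has_length S u m -> has_length S w n ->
    (m <= n)%N.

End ReflectionGroups.

Definition minimal_in (T : Type) (le : T -> T -> Prop) (A : set T) (x : T) :=
  A x /\ forall z, A z -> le z x -> z = x.

Definition is_int (F : pzRingType) (x : F) := exists m : int, x = m%:~R.
Definition is_rat (F : unitRingType) (x : F) := exists q : rat, x = ratr q.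

Definition dot (F : pzRingType) (r : nat) (u v : 'rV[F]_r) : F :=
  \sum_(i < r) u 0 i * v 0 i.

(* <x, b^\vee> = 2 (x, b) / (b, b). *)
Definition cpair (F : fieldType) (r : nat) (x b : 'rV[F]_r) : F :=
  2 * dot x b / dot b b.

(* An irreducible simply laced reduced root system of rank r, with a base and
   its maximal root.  Its real span is identified with R^r by means of an
   orthonormal basis for the invariant form normalized by (theta, theta) = 2. *)
Record root_datum (R : realType) (r : nat) := RootDatum {
  Phi : {fset 'rV[R]_r};
  alpha : 'I_r -> 'rV[R]_r;
  theta : 'rV[R]_r;
  Phi_span : <<Phi>>%VS = fullv;
  Phi_neq0 : forall b, b \in Phi -> b != 0;
  Phi_refl : forall a b, a \in Phi -> b \in Phi ->
    a - cpair a b *: b \in Phi;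
  Phi_int : forall a b, a \in Phi -> b \in Phi -> is_int (cpair a b);
  Phi_reduced : forall b (c : R), b \in Phi -> c *: b \in Phi ->
    c = 1 \/ c = -1;
  Phi_nonempty : Phi <> fset0;
  Phi_irr : forall A B : {fset 'rV[R]_r}, Phi = fsetU A B ->
    (forall a b, a \in A -> b \in B -> dot a b = 0) ->
    A = fset0 \/ B = fset0;
  Phi_simply_laced : forall a b, a \in Phi -> b \in Phi -> dot a a = dot b b;
  alpha_Phi : forall i, alpha i \in Phi;
  alpha_basis : basis_of fullv [seq alpha i | i : 'I_r];
  alpha_pos_or_neg : forall b, b \in Phi -> exists n : 'I_r -> nat,
    b = \sum_(i < r) alpha i *+ n i \/ b = - \sum_(i < r) alpha i *+ n i;
  theta_Phi : theta \in Phi;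
  theta_max : forall b, b \in Phi -> exists n : 'I_r -> nat,
    theta - b = \sum_(i < r) alpha i *+ n i;
  theta_norm : dot theta theta = 2
}.

Section Finite.
Variables (R : realType) (r : nat) (D : root_datum R r).
Local Notation V := 'rV[R]_r.

Definition dominance (x y : V) :=
  exists n : 'I_r -> nat, y - x = \sum_(i < r) alpha D i *+ n i.

Definition pos_root (b : V) := b \in Phi D /\ dominance 0 b.

Definition frho : V := 2^-1 *: \sum_(b <- Phi D | `[< pos_root b >]) b.

(* The dual Coxeter number. *)
Definition dcox : R := 1 + cpair frho (theta D).

Definition root_lattice : set V :=
  [set x | exists n : 'I_r -> int, x = \sum_(i < r) (alpha D i) *~ (n i)].

Definition weight : set V :=
  [set x | forall b, b \in Phi D -> is_int (cpair x b)].

Definition dominant : set V :=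
  [set x | weight x /\ forall i, 0 <= cpair x (alpha D i)].

Definition weyl : set (V -> V) :=
  generated [set s | exists2 b, b \in Phi D & s = (fun x => x - cpair x b *: b)].

(* W_e, as a group of affine transformations acting by the dot action. *)
Definition We (e : nat) : set (V -> V) :=
  [set f | exists u c, [/\ weyl u, root_lattice c &
     f = (fun x => u (x + frho) - frho + e%:R *: c)]].

Definition alcove (e : nat) : set V :=
  [set x | forall b, pos_root b -> 0 < cpair (x + frho) b < e%:R].

Definition alcove_closure (e : nat) : set V :=
  [set x | forall b, pos_root b -> 0 <= cpair (x + frho) b <= e%:R].

Definition hyperplane (v : V) (c : R) : set V :=
  [set x | cpair (x + frho) v = c].

(* The orthogonal reflection in [hyperplane v c]. *)
Definition hrefl (v : V) (c : R) : V -> V :=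
  fun x => x - (cpair (x + frho) v - c) *: v.

Definition We_reflection (e : nat) : set (V -> V) :=
  [set s | We e s /\ exists v c, v != 0 /\ s = hrefl v c].

Definition reflecting_hyperplane (e : nat) : set (set V) :=
  [set H | exists v c, [/\ v != 0, We e (hrefl v c) & H = hyperplane v c]].

(* A wall of the alcove is a reflecting hyperplane H that is the support of a
   facet in the closure, i.e. some point of the closure lies on H and on no
   other reflecting hyperplane. *)
Definition wall (e : nat) : set (set V) :=
  [set H | reflecting_hyperplane e H /\
     exists x, [/\ alcove_closure e x, H x &
       forall H', reflecting_hyperplane e H' -> H' x -> H' = H]].

Definition We_simple (e : nat) : set (V -> V) :=
  [set s | exists v c, [/\ v != 0, wall e (hyperplane v c) & s = hrefl v c]].

Definition le_e (e : nat) := bruhat (We_simple e).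

Inductive up_e (e : nat) (mu : V) : V -> Prop :=
| up_e_refl : weight mu -> up_e e mu mu
| up_e_step x s : up_e e mu x -> We_reflection e s -> weight (s x) ->
    dominance x (s x) -> up_e e mu (s x).

End Finite.

(* (x, a, b) stands for x + a chi + b delta in the dual of the affine Cartan
   subalgebra. *)
Notation hdual R r := ('rV[R[i]]_r * R[i]^o * R[i]^o)%type.

Section Affine.
Variables (R : realType) (r : nat) (D : root_datum R r).
Local Notation H := (hdual R r).

Definition fin (x : H) : 'rV[R[i]]_r := x.1.1.
Definition lev (x : H) : R[i] := x.1.2.
Definition del (x : H) : R[i] := x.2.

Definition complexify (v : 'rV[R]_r) : 'rV[R[i]]_r :=
  map_mx (real_complex R) v.

Definition rroot (j : int) (b : 'rV[R]_r) : H := (complexify b, 0, j%:~R).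

Definition real_root : set H :=
  [set a | exists j b, b \in Phi D /\ a = rroot j b].

Definition pos_real_root : set H :=
  [set a | exists j b, [/\ b \in Phi D, a = rroot j b &
     0 < j \/ (j = 0 /\ pos_root D b)]].

(* <x, a^\vee> for a real root a = j delta + b, where a^\vee = b^\vee + j c. *)
Definition apair (x a : H) : R[i] := cpair (fin x) (fin a) + del a * lev x.

Definition arefl (a : H) : H -> H := fun x => x - apair x a *: a.

Definition le_h (x y : H) :=
  exists (n0 : nat) (n : 'I_r -> nat),
    y - x = rroot 1 (- theta D) *+ n0 + \sum_(i < r) rroot 0 (alpha D i) *+ n i.

Definition arho : H :=
  (complexify (frho D), real_complex R (dcox D), 0).

Definition adot (w : H -> H) (x : H) : H := w (x + arho) - arho.

Definition Phi_of (lambda : H) : set H :=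
  [set a | real_root a /\ is_int (apair (lambda + arho) a)].

Definition Phi_of_pos (lambda : H) : set H :=
  Phi_of lambda `&` pos_real_root.

Definition W_of (lambda : H) : set (H -> H) :=
  generated (arefl @` Phi_of lambda).

Definition W_of_simple (lambda : H) : set (H -> H) :=
  [set s | exists a, [/\ Phi_of_pos lambda a, s = arefl a &
     arefl a @` (Phi_of_pos lambda `\ a) = Phi_of_pos lambda `\ a]].

Definition le_W (lambda : H) := bruhat (W_of_simple lambda).

Definition Cminus : set H :=
  [set x | lev (x + arho) != 0 /\
     forall a, Phi_of_pos x a -> apair (x + arho) a <= 0].

Definition Cminus_rat : set H :=
  [set x | [/\ Cminus x, forall i, is_int (apair x (rroot 0 (alpha D i))) &
     is_rat (lev x)]].

(* w is the longest element of the finite Weyl group, acting on H. *)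
Definition is_w0 (w : H -> H) :=
  longest [set s | exists i : 'I_r, s = arefl (rroot 0 (alpha D i))] w.

Definition conj_by (w0 y : H -> H) : H -> H := w0 \o y \o w0.

Definition le_W' (w0 : H -> H) (lambda : H) (y w : H -> H) :=
  le_W lambda (conj_by w0 y) (conj_by w0 w).

Definition dot_orbit (lambda : H) : set H :=
  [set mu | exists2 w, W_of lambda w & mu = adot w lambda].

Definition senders (lambda mu : H) : set (H -> H) :=
  [set w | W_of lambda w /\ adot w lambda = mu].

Inductive up_h (mu : H) : H -> Prop :=
| up_h_refl : up_h mu mu
| up_h_step x b : pos_real_root b -> le_h (adot (arefl b) x) x ->
    up_h mu (adot (arefl b) x) -> up_h mu x.

Definition e_of (l : nat) : nat := if odd l then l else l./2.

(* phi is the isomorphism phi_l from W_e to W(lambda); it is determined on W_e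
   by the listed values, and its values outside W_e are irrelevant. *)
Definition is_phi (l : nat) (lambda : H)
    (phi : ('rV[R]_r -> 'rV[R]_r) -> (H -> H)) :=
  [/\ set_bij (We D (e_of l)) (W_of lambda) phi,
      forall u v, We D (e_of l) u -> We D (e_of l) v ->
        phi (u \o v) = phi u \o phi v,
      forall i, phi (hrefl D (alpha D i) 0) = arefl (rroot 0 (alpha D i)) &
      phi (hrefl D (theta D) (- (e_of l)%:R)) =
        arefl (rroot (if odd l then 2 else 1) (- theta D))].

End Affine.

(* Main.v *)
Require Import Defs.
From mathcomp Require Import all_boot all_order all_algebra.
From mathcomp Require Import finmap complex.
From mathcomp Require Import boolp classical_sets functions reals.
From mathcomp Require Import ring lra zify.

(** Both [W_e] and the integral Weyl groups [W(lambda)] are generated by the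
    reflections of one affine root system, realized by affine functions on two
    different spaces, so the Coxeter theory is done once, for both, in terms of
    signs. A root has a label [(b, j)]; it defines an affine function [f a] and
    the reflection [tr a] in its zero set. With a base point [x0] in the
    fundamental alcove, the sign of [f a (w x0)] for a positive root [a] tells
    whether [tr a \o w] is longer or shorter than [w] ([strong_exchange]).
    Hence the Bruhat order consists of the chains of steps
    [y -> tr a \o y] with [a] positive and [0 < f a (y x0)] ([bruhatE]), and
    its lifting properties follow because right multiplication by a simple
    reflection [s] crosses a single mirror ([step_right], [chain_lower],
    [chain_raise]).

    The first equivalence holds because conjugating [phi] by [w0] maps the
    simple reflections of [W_e] onto those of [W(lambda0)]. The twist is needed
    since [phi] is prescribed on the reflection in [<x + rho, theta> = - e],
    whereas the wall of the alcove is [<x + rho, theta> = e]; as [w0] sends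
    [theta] to [- theta] and permutes the finite simple reflections, it repairs
    exactly this ([phi_order]). What has to be shown is that the simple
    reflections, defined on one side by walls and on the other by the
    permutation of the other positive roots, are the expected ones
    ([We_simpleE], [W_of_simpleE]).

    In (a) the steps of the linkage order move up in the dominance order, those
    of the Bruhat order move away from the alcove; the two directions agree for
    the mirrors [<x + rho, b> = n e] with [b] positive and [n >= 1]. From Bruhat to linkage one
    argues by induction on the length of the larger element, since the lifting
    properties hold for both kinds of steps and a right descent of a dominant
    alcove is a dominant alcove linked below it ([bruhat_to_up]). Conversely a
    chain of linkage steps may leave the dominant chamber, but a translation
    far into this chamber turns all its steps into Bruhat steps, and as lengths
    add up under this translation on dominant alcoves it can be cancelled
    ([up_to_bruhat], [cancel_left]).

    In (b) each step of [up_h] that is not trivial comes from a root of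
    [Phi(lambda)], because a multiple of a real root lying in the root lattice
    is an integral multiple ([le_h_multiple]); antidominance of [lambda] then
    identifies such steps with Bruhat steps. A chain ends in some element of
    the right coset, and a minimal element is below all of its coset since the
    stabilizer of [lambda] is generated by simple reflections
    ([stabilizer_word], [minimal_below_coset]). The primed statements reduce to
    the unprimed ones as [w0] is an involution. *)

Set Implicit Arguments.
Unset Strict Implicit.
Unset Printing Implicit Defensive.

Import Order.TTheory GRing.Theory Num.Theory.

Local Open Scope classical_set_scope.
Local Open Scope ring_scope.

(** * Words, chains and Bruhat orders *)

Section Words.
Variable T : Type.
Implicit Types (S : set (T -> T)) (s t u v w : T -> T).

Inductive chain (E : (T -> T) -> (T -> T) -> Prop) y : (T -> T) -> Prop :=
| chain_refl : chain E y y
| chain_step x z : chain E y x -> E x z -> chain E y z.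

Lemma chain_trans E y x z : chain E y x -> chain E x z -> chain E y z.
Proof. by move=> yx; elim=> // x' z' _ yx' xz; apply: chain_step xz. Qed.

Lemma chain1 (E : (T -> T) -> (T -> T) -> Prop) y z : E y z -> chain E y z.
Proof. by apply: chain_step; apply: chain_refl. Qed.

Lemma word_cat S m n u v :
  is_word S m u -> is_word S n v -> is_word S (m + n) (u \o v).
Proof.
by elim=> [|m' s w Ss _ IH] // Hv; rewrite addSn; exact: (word_cons Ss (IH Hv)).
Qed.

Lemma word1 S s : S s -> is_word S 1 s.
Proof. by move=> Ss; exact: (word_cons Ss (word_nil S)). Qed.

Lemma word_rcons S n w : is_word S n.+1 w ->
  exists s v, [/\ S s, is_word S n v & w = v \o s].
Proof.
elim: n w => [|n IH] w Hw; inversion Hw as [|n' s v Ss Hv]; subst.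
  by inversion Hv; subst; exists s, id; split=> //; exact: word_nil.
have [s' [v' [Ss' Hv' ->]]] := IH _ Hv.
by exists s', (s \o v'); split=> //; exact: word_cons.
Qed.

Lemma word_nilP S w : is_word S 0 w -> w = id.
Proof. by move=> H; inversion H. Qed.

Lemma generated_id S : generated S id.
Proof. by exists 0%N; apply: word_nil. Qed.

Lemma generated_comp S u v : generated S u -> generated S v ->
  generated S (u \o v).
Proof. by move=> [m Hu] [n Hv]; exists (m + n)%N; apply: word_cat. Qed.

Lemma generated_gen S s : S s -> generated S s.
Proof. by move=> Ss; exists 1%N; apply: word1. Qed.

Lemma generated_sub S S' : (forall s, S s -> generated S' s) ->
  generated S `<=` generated S'.
Proof.
move=> sub w [n]; elim=> [|m s v Ss _ IH]; first exact: generated_id.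
by apply: generated_comp => //; apply: sub.
Qed.

Lemma has_length_ex S w : generated S w -> exists n, has_length S w n.
Proof.
move=> [n Hn].
have ex : exists n, `[< is_word S n w >] by exists n; apply/asboolP.
exists (ex_minn ex); case: ex_minnP => m /asboolP Hm min; split=> // k Hk.
by apply: min; apply/asboolP.
Qed.

End Words.

Section Transport.
Variables (T T' : Type) (S : set (T -> T)) (S' : set (T' -> T')).
Variable psi : (T -> T) -> (T' -> T').
Hypothesis psi_gen : psi @` S = S'.
Hypothesis psi_id : psi id = id.
Hypothesis psi_comp : forall u v, generated S u -> generated S v ->
  psi (u \o v) = psi u \o psi v.
Hypothesis psi_inj : forall u v, generated S u -> generated S v ->
  psi u = psi v -> u = v.

Lemma word_push n w : is_word S n w -> is_word S' n (psi w).
Proof.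
elim=> [|m s v Ss Hv IH]; first by rewrite psi_id; apply: word_nil.
rewrite psi_comp; last by exists m.
  by apply: word_cons => //; rewrite -psi_gen; exists s.
exact: generated_gen.
Qed.

Lemma word_pull n w' : is_word S' n w' -> exists2 w, is_word S n w & psi w = w'.
Proof.
elim=> [|m s' v' Ss' _ [v Hv <-]]; first by exists id; [apply: word_nil|].
move: Ss'; rewrite -psi_gen => -[s Ss <-]; exists (s \o v); first exact: word_cons.
by rewrite psi_comp //; [apply: generated_gen|exists m].
Qed.

Lemma gen_push w : generated S w -> generated S' (psi w).
Proof. by case=> n /word_push; exists n. Qed.

Lemma gen_pull w' : generated S' w' -> exists2 w, generated S w & psi w = w'.
Proof. by case=> n /word_pull [w Hw <-]; exists w => //; exists n. Qed.

Lemma word_pushE n w : generated S w -> (is_word S' n (psi w) <-> is_word S n w).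
Proof.
move=> Gw; split=> [/word_pull [v Hv E]|]; last exact: word_push.
by rewrite -(psi_inj _ Gw E) //; exists n.
Qed.

Lemma length_pushE n w : generated S w ->
  (has_length S' (psi w) n <-> has_length S w n).
Proof.
move=> Gw; split=> -[Hw minw]; split.
- exact: (proj1 (word_pushE n Gw) Hw).
- by move=> m Hm; apply: minw; apply: word_push.
- exact: (word_push Hw).
- by move=> m Hm; apply: minw; apply: (proj1 (word_pushE m Gw) Hm).
Qed.

Lemma cox_gen u : cox_reflection S u -> generated S u.
Proof.
move=> [v [w [s [Gv Gw Ss _ ->]]]]; apply: generated_comp => //.
by apply: generated_comp => //; apply: generated_gen.
Qed.

Lemma cox_push t : cox_reflection S t -> cox_reflection S' (psi t).
Proof.
move=> [u [v [s [Gu Gv Ss uv ->]]]]; have Gs := generated_gen Ss.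
exists (psi u), (psi v), (psi s); split; try exact: gen_push.
- by rewrite -psi_gen; exists s.
- by rewrite -(psi_comp Gu Gv) uv psi_id.
- by rewrite (psi_comp (generated_comp Gu Gs) Gv) (psi_comp Gu Gs).
Qed.

Lemma cox_pull t' : cox_reflection S' t' -> exists2 t, cox_reflection S t & psi t = t'.
Proof.
move=> [u' [v' [s' [/gen_pull [u Gu <-] /gen_pull [v Gv <-]]]]].
rewrite -psi_gen => -[s Ss <-] uv ->; have Gs := generated_gen Ss.
exists (u \o s \o v); last first.
  by rewrite (psi_comp (generated_comp Gu Gs) Gv) (psi_comp Gu Gs).
exists u, v, s; split=> //.
apply: psi_inj; [exact: generated_comp|exact: generated_id|].
by rewrite (psi_comp Gu Gv) uv psi_id.
Qed.

Lemma bruhat_gen y w : bruhat S y w -> generated S y /\ generated S w.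
Proof.
elim=> [//|u x t m n _ [Gu Gx] Ht _ _ _]; split=> //.
by apply: generated_comp => //; apply: cox_gen.
Qed.

Lemma bruhat_push y w : bruhat S y w -> bruhat S' (psi y) (psi w).
Proof.
elim=> [v Gv|u x t m n ux IH Ht Hm Hn mn].
  by apply: bruhat_refl; apply: gen_push.
have [_ Gx] := bruhat_gen ux; have Gt := cox_gen Ht.
rewrite (psi_comp Gx Gt); apply: (bruhat_step (m := m) (n := n)) => //.
- exact: cox_push.
- exact: (proj2 (length_pushE m Gx) Hm).
- rewrite -(psi_comp Gx Gt); have Gxt := generated_comp Gx Gt.
  exact: (proj2 (length_pushE n Gxt) Hn).
Qed.

Lemma bruhat_pull y' w' : bruhat S' y' w' ->
  exists y w, [/\ psi y = y', psi w = w' & bruhat S y w].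
Proof.
elim=> [v' /gen_pull [v Gv <-]|u' x' t' m n _ [u [x [<- <- ux]]] /cox_pull [t Ht <-] Hm Hn mn].
  by exists v, v; split=> //; apply: bruhat_refl.
have [_ Gx] := bruhat_gen ux; have Gt := cox_gen Ht.
exists u, (x \o t); split=> //; first exact: psi_comp.
apply: (bruhat_step (m := m) (n := n)) => //; first exact: (proj1 (length_pushE m Gx) Hm).
have Gxt := generated_comp Gx Gt.
by apply: (proj1 (length_pushE n Gxt)); rewrite (psi_comp Gx Gt).
Qed.

Lemma bruhat_transport y w : generated S y -> generated S w ->
  (bruhat S y w <-> bruhat S' (psi y) (psi w)).
Proof.
move=> Gy Gw; split=> [|/bruhat_pull [y1 [w1 [Ey Ew yw]]]]; first exact: bruhat_push.
have [Gy1 Gw1] := bruhat_gen yw.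
by rewrite -(psi_inj Gy1 Gy Ey) -(psi_inj Gw1 Gw Ew).
Qed.

End Transport.

(** * Reflections described by signs *)

(** A root system with a base, seen through labels: [sr b a] is the label of
    the image of the root [a] under the reflection in [b]. The last field is
    induction along the descents of a positive root to a simple one. *)
Record root_labels (L : zmodType) (Rt Pos Pi : set L) (sr : L -> L -> L) : Prop :=
  RootLabels {
    rl_opp : forall a, Rt a -> Rt (- a);
    rl_sr : forall a b, Rt a -> Rt b -> Rt (sr b a);
    rl_srN : forall a b, sr b (- a) = - sr b a;
    rl_self : forall a, Rt a -> sr a a = - a;
    rl_sign : forall a, Rt a -> Pos a \/ Pos (- a);
    rl_simple : forall c, Pi c -> Rt c /\ Pos c;
    rl_perm : forall c a, Pi c -> Rt a -> Pos a -> a <> c -> Pos (sr c a);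
    rl_ind : forall P : L -> Prop, (forall c, Pi c -> P c) ->
      (forall a c, Pi c -> Rt a -> Pos a -> Pos (sr c a) -> P (sr c a) -> P a) ->
      forall a, Rt a -> Pos a -> P a }.

(** The root [a] acts on points through the affine function [f a] and the
    reflection [tr a] in its zero set, and [x0] is a point of the alcove on
    which the positive roots are positive. *)
Record realization (F : numDomainType) (X : Type) (L : zmodType)
    (Rt Pos : set L) (sr : L -> L -> L) (f : L -> X -> F) (tr : L -> X -> X)
    (x0 : X) : Prop :=
  Realization {
    rz_opp : forall a x, f (- a) x = - f a x;
    rz_tr : forall a b x, Rt a -> Rt b -> f a (tr b x) = f (sr b a) x;
    rz_trN : forall a, Rt a -> tr (- a) = tr a;
    rz_trK : forall a, Rt a -> tr a \o tr a = id;
    rz_conj : forall a b, Rt a -> Rt b -> tr (sr b a) = tr b \o tr a \o tr b;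
    rz_inj : forall a b, Rt a -> Rt b -> tr a = tr b -> a = b \/ a = - b;
    rz_pos : forall a, Rt a -> Pos a -> 0 < f a x0 }.

Section Reflections.
Variables (F : numDomainType) (X : Type) (L : zmodType).
Variables (Rt Pos Pi : set L) (sr : L -> L -> L).
Variables (f : L -> X -> F) (tr : L -> X -> X) (x0 : X).
Hypothesis rl : root_labels Rt Pos Pi sr.
Hypothesis rz : realization Rt Pos sr f tr x0.

Local Notation S := (tr @` Pi).
Local Notation G := (generated S).

Let simple_root c : Pi c -> Rt c. Proof. by case/(rl_simple rl). Qed.
Let simple_pos c : Pi c -> Pos c. Proof. by case/(rl_simple rl). Qed.

Lemma trK_app a (w : X -> X) : Rt a -> tr a \o (tr a \o w) = w.
Proof. by move=> Ra; rewrite compA (rz_trK rz Ra). Qed.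

Lemma f_self a x : Rt a -> f a (tr a x) = - f a x.
Proof. by move=> Ra; rewrite (rz_tr rz) // (rl_self rl Ra) (rz_opp rz). Qed.

Lemma simple_gen c : Pi c -> G (tr c).
Proof. by move=> Pc; apply: generated_gen; exists c. Qed.

Lemma word_inv n w : is_word S n w ->
  exists v, [/\ is_word S n v, v \o w = id & w \o v = id].
Proof.
elim=> [|m s u Ss _ [v [Hv vu uv]]]; first by exists id; split=> //; apply: word_nil.
have [c Pc cs] := Ss; have ss : s \o s = id.
  by rewrite -cs (rz_trK rz) //; apply: simple_root.
exists (v \o s); split.
- by rewrite -addn1; apply: word_cat => //; apply: word1.
- by rewrite -[RHS]vu; apply/funext => x /=; rewrite -{2}[u x]/(id (u x)) -ss.
- by rewrite -[RHS]ss; apply/funext => x /=; rewrite -{2}[s x]/(id (s x)) -uv.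
Qed.

Lemma gen_inv w : G w -> exists v, [/\ G v, v \o w = id & w \o v = id].
Proof. by move=> [n /word_inv [v [Hv ? ?]]]; exists v; split=> //; exists n. Qed.

Lemma pos_of a : Rt a -> 0 < f a x0 -> Pos a.
Proof.
move=> Ra fa; case: (rl_sign rl Ra) => // Pa.
have := rz_pos rz (rl_opp rl Ra) Pa.
by rewrite (rz_opp rz) oppr_gt0 => /(lt_trans fa); rewrite ltxx.
Qed.

Lemma neg_of a : Rt a -> f a x0 < 0 -> Pos (- a).
Proof.
by move=> Ra fa; apply: pos_of; rewrite ?(rz_opp rz) ?oppr_gt0 //; apply: (rl_opp rl).
Qed.

(** The group permutes the roots. It does not act on labels, so the image [b]
    of [a] under [w] is only characterized by its function and reflection. *)
Lemma move_root w a : G w -> Rt a ->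
  exists b, [/\ Rt b, forall x, f b (w x) = f a x & tr b \o w = w \o tr a].
Proof.
move=> [n Hw] Ra; elim: Hw => [|m s u [c Pc <-] _ [b [Rb fb tb]]].
  by exists a.
have Rc := simple_root Pc.
exists (sr c b); split; first exact: (rl_sr rl).
  move=> x; rewrite -(rz_tr rz) //= -fb; congr (f b _).
  exact: (congr1 (fun h => h (u x)) (rz_trK rz Rc)).
rewrite (rz_conj rz) //; apply/funext => x /=.
have -> : tr c (tr c (u x)) = u x.
  exact: (congr1 (fun h => h (u x)) (rz_trK rz Rc)).
by have /(congr1 (fun h => h x)) /= -> := tb.
Qed.

Lemma pull_root w a : G w -> Rt a ->
  exists b, [/\ Rt b, forall x, f b x = f a (w x) & tr a \o w = w \o tr b].
Proof.
move=> Gw Ra; have [v [Gv vw wv]] := gen_inv Gw.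
have [b [Rb fb tb]] := move_root Gv Ra.
have vwE x : v (w x) = x by exact: (congr1 (fun h => h x) vw).
have wvE x : w (v x) = x by exact: (congr1 (fun h => h x) wv).
exists b; split=> // [x|]; first by rewrite -fb vwE.
apply/funext => x /=; rewrite -{2}[x]vwE.
by have /(congr1 (fun h => h (w x))) /= -> := tb; rewrite wvE.
Qed.

Lemma sign_orbit w a : G w -> Rt a -> 0 < f a (w x0) \/ f a (w x0) < 0.
Proof.
move=> Gw Ra; have [b [Rb <- _]] := pull_root Gw Ra.
case: (rl_sign rl Rb) => Pb; [left; exact: (rz_pos rz)|right].
by have := rz_pos rz (rl_opp rl Rb) Pb; rewrite (rz_opp rz) oppr_gt0.
Qed.

(** Either the first letter of the word is [tr a] itself, or it keeps the
    positive root [a] positive and the letter to delete lies further right. *)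
Lemma strong_exchange n w a : is_word S n w -> Rt a -> Pos a ->
  f a (w x0) < 0 -> (0 < n)%N /\ is_word S n.-1 (tr a \o w).
Proof.
move=> Hw; elim: Hw a => [|m s u [c Pc <-] Hu IH] a Ra Pa fa.
  by have := rz_pos rz Ra Pa => /(lt_trans fa); rewrite ltxx.
split=> //=; have Rc := simple_root Pc.
have [ac|ac] := pselect (a = c); first by rewrite ac trK_app.
have Psa := rl_perm rl Pc Ra Pa ac; have Rsa := rl_sr rl Ra Rc.
rewrite /= (rz_tr rz) // in fa.
have [m0 Hm] := IH _ Rsa Psa fa.
have -> : tr a \o (tr c \o u) = tr c \o (tr (sr c a) \o u).
  rewrite (rz_conj rz) //; apply/funext => x /=.
  by rewrite -[RHS]/((tr c \o tr c) _) (rz_trK rz).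
by rewrite -(prednK m0); apply: word_cons => //; exists c.
Qed.

(** Every positive root descends to a simple one by simple reflections. *)
Lemma tr_cox_reflection a : Rt a -> cox_reflection S (tr a).
Proof.
have pos b : Rt b -> Pos b -> cox_reflection S (tr b).
  move: b; apply: (rl_ind rl) => [c Pc|b c Pc Rb Pb Psb [u [v [s [Gu Gv Ss uv E]]]]].
    by exists id, id, (tr c); split=> //; exact: generated_id.
  have Rc := simple_root Pc.
  have ccE x : tr c (tr c x) = x by exact: (congr1 (fun h => h x) (rz_trK rz Rc)).
  exists (tr c \o u), (v \o tr c), s; split=> //.
  - by apply: generated_comp => //; apply: simple_gen.
  - by apply: generated_comp => //; apply: simple_gen.
  - apply/funext => x /=; rewrite -[u _]/((u \o v) _) uv; exact: ccE.
  - have {}E x : tr (sr c b) x = u (s (v x)) by rewrite E.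
    apply/funext => x /=; rewrite -E (rz_conj rz) //=.
    by rewrite !ccE.
move=> Ra; case: (rl_sign rl Ra) => Pa; first exact: pos.
by rewrite -(rz_trN rz) //; apply: pos => //; apply: (rl_opp rl).
Qed.

Lemma cox_reflectionE : cox_reflection S = tr @` Rt.
Proof.
apply/seteqP; split=> [t [u [v [_ [Gu Gv [c Pc <-] uv ->]]]]|_ [a Ra <-]]; last first.
  exact: tr_cox_reflection.
have [b [Rb _ tb]] := move_root Gu (simple_root Pc).
by exists b => //; rewrite -tb -compA uv.
Qed.

Lemma tr_gen a : Rt a -> G (tr a).
Proof.
move=> /tr_cox_reflection [u [v [s [Gu Gv Ss _ ->]]]].
by do 2![apply: generated_comp => //]; apply: generated_gen.
Qed.

Lemma generated_roots : generated (tr @` Rt) = G.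
Proof.
apply/seteqP; split; apply: generated_sub.
  by move=> _ [a Ra <-]; apply: tr_gen.
by move=> _ [c Pc <-]; apply: generated_gen; exists c => //; apply: simple_root.
Qed.

(** Crossing the mirror of a root [a] in [Q] from its positive side. For [Q]
    the positive roots these are the steps of the Bruhat order; the steps of the
    linkage order are obtained from another choice of [Q]. *)
Definition rstep (Q : set L) (y w : X -> X) :=
  exists a, [/\ Rt a, Q a, 0 < f a (y x0) & w = tr a \o y].

Lemma rstep_gen Q y w : rstep Q y w -> G y -> G w.
Proof.
by move=> [a [Ra _ _ ->]] Gy; apply: generated_comp => //; apply: tr_gen.
Qed.

Lemma chain_gen Q y w : chain (rstep Q) y w -> G y -> G w.
Proof. by elim=> // x z _ IH st /IH; apply: rstep_gen st. Qed.

Lemma rstep_down n y w : rstep Pos y w -> is_word S n w ->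
  (0 < n)%N /\ is_word S n.-1 y.
Proof.
move=> [a [Ra Pa fa ->]] Hw.
have fa' : f a ((tr a \o y) x0) < 0 by rewrite /= f_self // oppr_lt0.
by have := strong_exchange Hw Ra Pa fa'; rewrite trK_app.
Qed.

(** By [strong_exchange] the length increases under [y -> tr a \o y], for a
    positive root [a], exactly when [0 < f a (y x0)]. *)
Lemma bruhatE y w : bruhat S y w <-> G y /\ chain (rstep Pos) y w.
Proof.
split=> [|[Gy]].
  elim=> [v Gv|u x t m n _ [Gu ux]]; first by split=> //; apply: chain_refl.
  rewrite cox_reflectionE => -[c Rc <-] [Hm _] [Hn minn] mn.
  have Gx := chain_gen ux Gu.
  split=> //; apply: chain_step ux _.
  have [b [Rb Pb tb]] : exists b, [/\ Rt b, Pos b & tr b \o x = x \o tr c].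
    have [b [Rb _ tb]] := move_root Gx Rc.
    case: (rl_sign rl Rb) => Pb; first by exists b.
    by exists (- b); rewrite (rz_trN rz) //; split=> //; apply: (rl_opp rl).
  exists b; split=> //; case: (sign_orbit Gx Rb) => // fb.
  have [m0 Hm'] := strong_exchange Hm Rb Pb fb.
  by rewrite tb in Hm'; have := minn _ Hm'; lia.
elim=> [|x z yx IH st]; first exact: bruhat_refl.
have Gx := chain_gen yx Gy.
have Gz := rstep_gen st Gx.
have [m Hm] := has_length_ex Gx; have [n Hn] := has_length_ex Gz.
have [n0 Hn'] := rstep_down st (proj1 Hn).
case: (st) => a [Ra Pa fa zE]; have [c [Rc _ tc]] := pull_root Gx Ra.
have {}zE : z = x \o tr c by rewrite zE.
rewrite zE in Hn |- *; apply: (bruhat_step IH _ Hm Hn); last first.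
  by have := (proj2 Hm) _ Hn'; lia.
by rewrite cox_reflectionE; exists c.
Qed.

(** The points [x0] and [tr c x0] are separated by the mirror of [c] only,
    so [y x0] and [y (tr c x0)] are separated only by the mirror of [y c]. *)
Lemma keep_sign y c a : G y -> Pi c -> Rt a -> 0 < f a (y x0) ->
  tr a \o y = y \o tr c \/ 0 < f a (y (tr c x0)).
Proof.
move=> Gy Pc Ra fa; have [b [Rb fb tb]] := pull_root Gy Ra.
have [bc|bc] := pselect (b = c); first by left; rewrite tb bc.
right; rewrite -fb (rz_tr rz) //; last exact: simple_root.
apply: (rz_pos rz); first by apply: (rl_sr rl) => //; apply: simple_root.
by apply: (rl_perm rl) => //; apply: pos_of => //; rewrite fb.
Qed.

Lemma step_right Q y w c : G y -> Pi c -> rstep Q y w ->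
  w = y \o tr c \/ rstep Q (y \o tr c) (w \o tr c).
Proof.
move=> Gy Pc [a [Ra Qa fa ->]].
by case: (keep_sign Gy Pc Ra fa) => [->|fa']; [left|right; exists a].
Qed.

(** Along the chain, right multiplication by [tr c] either transports a step
    or undoes it, see [step_right]. *)
Lemma chain_lower Q y w c : G y -> Pi c -> chain (rstep Q) y w ->
  rstep Q y (y \o tr c) -> chain (rstep Q) y (w \o tr c).
Proof.
move=> Gy Pc; elim=> [|x z yx IH xz] st; first exact: chain1.
case: (step_right (chain_gen yx Gy) Pc xz) => [->|st'].
  by rewrite -compA (rz_trK rz) //; apply: simple_root.
exact: chain_step (IH st) st'.
Qed.

Lemma chain_raise Q y w c : G y -> Pi c -> chain (rstep Q) y w ->
  rstep Q (w \o tr c) w -> chain (rstep Q) (y \o tr c) w.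
Proof.
move=> Gy Pc yw st.
have gen x : chain (rstep Q) y x -> chain (rstep Q) x w ->
    chain (rstep Q) (x \o tr c) w -> chain (rstep Q) (y \o tr c) w.
  elim=> // x1 x2 yx1 IH x12 x2w x2cw; apply: IH.
    exact: chain_trans (chain1 x12) x2w.
  case: (step_right (chain_gen yx1 Gy) Pc x12) => [<- //|st'].
  exact: chain_trans (chain1 st') x2cw.
apply: gen yw (chain_refl _ _) _; exact: chain1.
Qed.

Lemma right_comparable y c : G y -> Pi c ->
  rstep Pos y (y \o tr c) \/ rstep Pos (y \o tr c) y.
Proof.
move=> Gy Pc.
have [b [Rb Pb tb]] : exists b, [/\ Rt b, Pos b & tr b \o y = y \o tr c].
  have [b [Rb _ tb]] := move_root Gy (simple_root Pc).
  case: (rl_sign rl Rb) => Pb; first by exists b.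
  by exists (- b); rewrite (rz_trN rz) //; split=> //; apply: (rl_opp rl).
case: (sign_orbit Gy Rb) => fb; [left|right]; exists b; split=> //.
  by rewrite -tb /= f_self // oppr_gt0.
by rewrite -tb trK_app.
Qed.

Lemma rstep_irrefl y : ~ rstep Pos y y.
Proof.
move=> [a [Ra _ fa E]]; have := f_self (y x0) Ra.
rewrite -[tr a _]/((tr a \o y) x0) -E => fE.
by move: (fa); rewrite fE oppr_gt0 => /(lt_trans fa); rewrite ltxx.
Qed.

Lemma last_letter n w : has_length S w n.+1 ->
  exists c v, [/\ Pi c, is_word S n v, w = v \o tr c & rstep Pos v w].
Proof.
move=> [Hw minw]; have [_ [v [[c Pc <-] Hv wE]]] := word_rcons Hw.
exists c, v; split=> //; have Gv : G v by exists n.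
rewrite wE; case: (right_comparable Gv Pc) => // st.
have [n0 Hn] := rstep_down st Hv.
by rewrite -wE in Hn; have := minw _ Hn; lia.
Qed.

Lemma first_letter n w : has_length S w n.+1 ->
  exists c v, [/\ Pi c, has_length S v n, w = tr c \o v & f c (w x0) < 0].
Proof.
move=> [Hw minw]; inversion Hw as [|n' s v [c Pc cs] Hv]; subst.
exists c, v; split=> //.
  split=> // m Hm; have Ss : S (tr c) by exists c.
  by have := minw _ (word_cons Ss Hm).
have Gv : G v by exists n.
have Rc := simple_root Pc; rewrite /= f_self // oppr_lt0.
case: (sign_orbit Gv Rc) => // fc.
have [n0 Hn] := strong_exchange Hv Rc (simple_pos Pc) fc.
by have := minw _ Hn; lia.
Qed.

Lemma id_of_positive w : G w -> (forall c, Pi c -> 0 < f c (w x0)) -> w = id.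
Proof.
move=> Gw pos; have [[|n] Hn] := has_length_ex Gw.
  by apply: word_nilP (proj1 Hn).
have [c [v [Pc _ _ fc]]] := first_letter Hn.
by have := lt_trans fc (pos _ Pc); rewrite ltxx.
Qed.

Lemma regular_inj y z : G y -> G z -> y x0 = z x0 -> y = z.
Proof.
move=> Gy Gz yz; have [v [Gv vz zv]] := gen_inv Gz.
have /id_of_positive : G (v \o y) by apply: generated_comp.
move=> H; suff vy : v \o y = id.
  by rewrite -[LHS]/(id \o y) -zv -compA vy.
apply: H => c Pc /=; rewrite yz -[v _]/((v \o z) x0) vz /=.
by apply: (rz_pos rz); [exact: simple_root|exact: simple_pos].
Qed.

(** For left multiplication by a simple reflection the step itself is
    conjugated, so positivity of the root has to survive this: the argument is
    restricted to the Bruhat order, and each element of the chain is replaced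
    by the shorter one of [y] and [tr c \o y]. *)
Section LeftLifting.
Variable c : L.
Hypothesis Pc : Pi c.

Let lower y := if 0 < f c (y x0) then y else tr c \o y.

Lemma lower_step y w : G y -> rstep Pos y w ->
  chain (rstep Pos) (lower y) (lower w).
Proof.
move=> Gy st; have Gw := rstep_gen st Gy; case: st => a [Ra Pa fa wE].
have Rc := simple_root Pc.
have [ac|ac] := pselect (a = c).
  have fw : f c (w x0) = - f c (y x0) by rewrite wE ac /= f_self.
  rewrite /lower fw -ac fa oppr_gt0 (lt_gtF fa) wE trK_app //.
  exact: chain_refl.
have st : rstep Pos y w by exists a.
have cst : rstep Pos (tr c \o y) (tr c \o w).
  have Rs := rl_sr rl Ra Rc.
  exists (sr c a); split=> //; first exact: (rl_perm rl).
    rewrite /= -(rz_tr rz) //.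
    by rewrite -[tr c (tr c _)]/((tr c \o tr c) _) (rz_trK rz).
  rewrite wE (rz_conj rz) //; apply/funext => x /=.
  by rewrite -[tr c (tr c (y x))]/((tr c \o tr c) _) (rz_trK rz).
rewrite /lower; case: (sign_orbit Gy Rc) => fy; case: (sign_orbit Gw Rc) => fw.
- by rewrite fy fw; apply: chain1.
- rewrite fy (lt_gtF fw); apply: chain_trans (chain1 cst).
  apply: chain1; exists c; split=> //; exact: simple_pos.
- rewrite (lt_gtF fy) fw; apply: chain_trans (chain1 st).
  apply: chain1; exists c; split=> //; first exact: simple_pos.
    by rewrite /= f_self // oppr_gt0.
  by rewrite trK_app.
- by rewrite (lt_gtF fy) (lt_gtF fw); apply: chain1.
Qed.

Lemma lift_left y w : G y -> chain (rstep Pos) y w ->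
  f c (y x0) < 0 -> f c (w x0) < 0 ->
  chain (rstep Pos) (tr c \o y) (tr c \o w).
Proof.
move=> Gy yw fy fw.
have : chain (rstep Pos) (lower y) (lower w).
  elim: yw => [|x z yx IH st]; first exact: chain_refl.
  exact: chain_trans IH (lower_step (chain_gen yx Gy) st).
by rewrite /lower (lt_gtF fy) (lt_gtF fw).
Qed.

End LeftLifting.

(** The condition on signs says that every mirror separating [t x0] from [x0]
    also separates [t (y x0)] and [t (w x0)] from [x0], that is, the lengths of
    [t] and of [y], [w] add up. The letters of [t] can then be removed from the
    left one by one. *)
Lemma cancel_left n t y w : has_length S t n -> G y -> G w ->
  (forall a, Rt a -> Pos a -> f a (t x0) < 0 ->
     f a (t (y x0)) < 0 /\ f a (t (w x0)) < 0) ->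
  chain (rstep Pos) (t \o y) (t \o w) -> chain (rstep Pos) y w.
Proof.
elim: n t => [|n IH] t Ht Gy Gw sep; first by rewrite (word_nilP (proj1 Ht)).
have [c [v [Pc Hv tE fc]]] := first_letter Ht => ch.
have Rc := simple_root Pc.
have [fy fw] := sep _ Rc (simple_pos Pc) fc.
have Gt : G t by exists n.+1; case: Ht.
have vE : tr c \o t = v by rewrite tE trK_app.
have vEx x : tr c (t x) = v x by rewrite -vE.
have fv : 0 < f c (v x0) by rewrite -vEx f_self // oppr_gt0.
apply: (IH v) => //; last first.
  rewrite -vE; apply: (lift_left Pc _ ch) => //.
  exact: generated_comp.
move=> a Ra Pa fa.
have ac : a <> c by move=> ac; rewrite ac in fa; have := lt_trans fa fv; rewrite ltxx.
have Rs := rl_sr rl Ra Rc.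
rewrite -!vEx !(rz_tr rz) //; apply: sep => //; first exact: (rl_perm rl).
by rewrite -(rz_tr rz) // vEx.
Qed.

(** If [u] fixes the antidominant point [p] and its first letter is [tr c], the
    preimage of [c] under [u] is a negative root, so that [f c p] is both
    nonpositive and nonnegative. *)
Lemma stabilizer_word p u : (forall a, Rt a -> Pos a -> f a p <= 0) ->
  (forall a, Rt a -> f a p = 0 -> tr a p = p) -> G u -> u p = p ->
  generated (tr @` [set c | Pi c /\ f c p = 0]) u.
Proof.
move=> anti fix0 Gu; have [n Hn] := has_length_ex Gu.
elim: n u Gu Hn => [|n IH] u Gu Hn up.
  by rewrite (word_nilP (proj1 Hn)); apply: generated_id.
have [c [v [Pc Hv uE fc]]] := first_letter Hn; have Rc := simple_root Pc.
have [b [Rb fb _]] := pull_root Gu Rc.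
have Pb : Pos (- b) by apply: neg_of => //; rewrite fb.
have fp : f c p = 0.
  apply/le_anti; rewrite (anti _ Rc (simple_pos Pc)) /=.
  have := anti _ (rl_opp rl Rb) Pb.
  by rewrite (rz_opp rz) oppr_le0 fb up.
rewrite uE; apply: generated_comp; first by apply: generated_gen; exists c.
apply: IH => //; first by exists n; case: Hv.
by rewrite -[v p](congr1 (fun h => h (v p)) (rz_trK rz Rc)) /= -[tr c (v p)]/((tr c \o v) p) -uE up fix0.
Qed.

Lemma minimal_below_coset p y u : (forall a, Rt a -> Pos a -> f a p <= 0) ->
  (forall a, Rt a -> f a p = 0 -> tr a p = p) ->
  G y -> G u -> u p = p ->
  (forall z, G z -> z p = y p -> bruhat S z y -> z = y) ->
  chain (rstep Pos) y (y \o u).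
Proof.
move=> anti fix0 Gy Gu up miny.
have [n] := stabilizer_word anti fix0 Gu up.
elim: n u {Gu up} => [|n IH] u Hu; first by rewrite (word_nilP Hu); apply: chain_refl.
have [_ [v [[c [Pc fc] <-] Hv ->]]] := word_rcons Hu.
have Rc := simple_root Pc.
apply: (chain_lower Gy Pc (IH _ Hv)).
case: (right_comparable Gy Pc) => // st.
have Gyc : G (y \o tr c) by apply: generated_comp => //; apply: simple_gen.
have E : y \o tr c = y.
  apply: miny => //; first by rewrite /= fix0.
  by apply/bruhatE; split=> //; apply: chain1.
by case: (rstep_irrefl (y := y)); rewrite E in st.
Qed.

Lemma longest_neg w c : longest S w -> Pi c -> f c (w x0) < 0.
Proof.
move=> [Gw maxw] Pc; have Rc := simple_root Pc.
case: (sign_orbit Gw Rc) => // fc.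
have st : rstep Pos w (tr c \o w) by exists c; split=> //; apply: simple_pos.
have Gcw := rstep_gen st Gw.
have [m Hm] := has_length_ex Gw; have [n Hn] := has_length_ex Gcw.
have [n0 Hn'] := rstep_down st (proj1 Hn).
have := maxw _ _ _ Gcw Hn Hm; have := (proj2 Hm) _ Hn'; lia.
Qed.

(** Conjugating an involution [g] by its first letter [tr c] decreases the
    length by two, unless [g] takes [c] to [- c]. This recognizes the
    reflections in the group among all maps that are orthogonal reflections. *)
Lemma involution_conj (P : set (X -> X)) :
  (forall c g, Pi c -> G g -> P g -> P (tr c \o g \o tr c)) ->
  forall g, G g -> P g -> g \o g = id -> g <> id ->
  exists u v, [/\ G u, v \o u = id, u \o v = id, P (v \o g \o u) &
    exists2 c, Pi c & forall x, f c (v (g (u x))) = - f c x].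
Proof.
move=> Pconj g [n]; elim/ltn_ind: n g => n IH g Hn Pg gg gid.
have Gg : G g by exists n.
have [m Hm] := has_length_ex Gg.
case: m Hm => [|m] Hm; first by case: gid; apply: word_nilP (proj1 Hm).
have mn : (m < n)%N by apply: (proj2 Hm).
have [c [v [Pc Hv gE fc]]] := first_letter Hm; have Rc := simple_root Pc.
have [b [Rb fb _]] := pull_root Gg Rc.
have ccE x : tr c (tr c x) = x by exact: (congr1 (fun h => h x) (rz_trK rz Rc)).
have ggE x : g (g x) = x by exact: (congr1 (fun h => h x) gg).
have Pb : Pos (- b) by apply: neg_of => //; rewrite fb.
have [bc|bc] := pselect (- b = c).
  exists id, id; split=> //; first exact: generated_id.
  by exists c => // x; rewrite -fb -bc (rz_opp rz) opprK.
have Psb := rl_perm rl Pc (rl_opp rl Rb) Pb bc.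
(* [g \o tr c] is the inverse of [tr c \o g], hence as short. *)
have Hgc : is_word S m (g \o tr c).
  have [v' [Hv' v'v vv']] := word_inv (proj1 Hv).
  suff -> : g \o tr c = v' by [].
  have v'vE x : v' (v x) = x by exact: (congr1 (fun h => h x) v'v).
  apply/funext => x /=; rewrite -[in RHS](ccE x) -[in RHS](ggE (tr c x)).
  by rewrite {2}gE /= ccE v'vE.
have fgc : f c ((g \o tr c) x0) < 0.
  rewrite /= -fb (rz_tr rz) // -oppr_gt0 -(rz_opp rz).
  rewrite -(rl_srN rl); apply: (rz_pos rz) => //.
  by apply: (rl_sr rl) => //; apply: (rl_opp rl).
have [m0 Hcgc] := strong_exchange Hgc Rc (simple_pos Pc) fgc.
rewrite compA in Hcgc.
have Gc := simple_gen Pc.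
have mn' : (m.-1 < n)%N by lia.
have [|||u [v1 [Gu vu uv Ph ex]]] := IH _ mn' _ Hcgc.
- exact: Pconj.
- by apply/funext => x /=; rewrite ccE ggE ccE.
- move=> E; apply: gid; apply/funext => x.
  have := congr1 (fun h => tr c (h (tr c x))) E => /=.
  by rewrite !ccE.
exists (tr c \o u), (v1 \o tr c); split=> //.
- exact: generated_comp.
- by apply/funext => x /=; rewrite ccE -[LHS]/((v1 \o u) x) vu.
- by apply/funext => x /=; rewrite -[u _]/((u \o v1) _) uv; apply: ccE.
Qed.

End Reflections.

(** * Roots and their coordinates *)

Section Dot.
Variables (F : comPzRingType) (r : nat).
Implicit Types (u v w : 'rV[F]_r).

Lemma dotC u v : dot u v = dot v u.
Proof. by apply: eq_bigr => i _; rewrite mulrC. Qed.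

Lemma dotDl u v w : dot (u + v) w = dot u w + dot v w.
Proof. by rewrite -big_split /=; apply: eq_bigr => i _; rewrite mxE mulrDl. Qed.

Lemma dotZl k u w : dot (k *: u) w = k * dot u w.
Proof. by rewrite /dot mulr_sumr; apply: eq_bigr => i _; rewrite mxE mulrA. Qed.

Lemma dotNl u w : dot (- u) w = - dot u w.
Proof. by rewrite -scaleN1r dotZl mulN1r. Qed.

Lemma dot0l w : dot 0 w = 0.
Proof. by rewrite -(scale0r 0) dotZl mul0r. Qed.

Lemma dotDr u v w : dot w (u + v) = dot w u + dot w v.
Proof. by rewrite dotC dotDl !(dotC w). Qed.

Lemma dotZr k u w : dot w (k *: u) = k * dot w u.
Proof. by rewrite dotC dotZl dotC. Qed.

Lemma dotNr u w : dot w (- u) = - dot w u.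
Proof. by rewrite dotC dotNl dotC. Qed.

Lemma dot_suml (I : Type) (s : seq I) (P : pred I) (E : I -> 'rV[F]_r) w :
  dot (\sum_(i <- s | P i) E i) w = \sum_(i <- s | P i) dot (E i) w.
Proof.
by elim/big_rec2: _ => [|i y x _ <-]; rewrite ?dot0l ?dotDl.
Qed.

Lemma dot_delta w j : dot w (delta_mx 0 j) = w 0 j.
Proof.
rewrite /dot (bigD1 j) //= !mxE !eqxx mulr1 big1 ?addr0 // => i /negPf ij.
by rewrite !mxE ij andbF mulr0.
Qed.

Lemma dot_inj u v : (forall w, dot w u = dot w v) -> u = v.
Proof. by move=> H; apply/rowP => j; rewrite -!dot_delta -!(dotC (delta_mx _ _)) H. Qed.

End Dot.

Lemma dot_map (F K : comPzRingType) (h : {rmorphism F -> K}) r (u v : 'rV[F]_r) :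
  dot (map_mx h u) (map_mx h v) = h (dot u v).
Proof. by rewrite /dot rmorph_sum; apply: eq_bigr => i _; rewrite !mxE rmorphM. Qed.

Lemma is_intP (R : archiNumDomainType) (x : R) : is_int x <-> x \is a Num.int.
Proof. by split=> [[m ->]|/intrP //]; apply: intr_int. Qed.

Section Roots.
Variables (R : realType) (r : nat) (D : root_datum R r).
Local Notation V := 'rV[R]_r.
Local Notation Phi := (Phi D).
Local Notation alpha := (alpha D).
Local Notation theta := (theta D).
Local Notation pos_root := (pos_root D).

Lemma dot_root b : b \in Phi -> dot b b = 2.
Proof. by move=> Hb; rewrite (Phi_simply_laced Hb (theta_Phi D)) theta_norm. Qed.

Lemma cpair_root x b : b \in Phi -> cpair x b = dot x b.
Proof. by move=> Hb; rewrite /cpair dot_root // mulrAC divff ?mul1r // pnatr_eq0. Qed.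

Lemma int_dot_root a b : a \in Phi -> b \in Phi -> dot a b \is a Num.int.
Proof. by move=> Ha Hb; apply/is_intP; rewrite -cpair_root //; exact: (Phi_int Ha Hb). Qed.

Lemma root_reflect a b : a \in Phi -> b \in Phi -> a - dot a b *: b \in Phi.
Proof. by move=> Ha Hb; rewrite -cpair_root //; apply: Phi_refl. Qed.

Lemma root_opp b : b \in Phi -> - b \in Phi.
Proof.
move=> Hb; have := root_reflect Hb Hb; rewrite dot_root //.
by rewrite scaler_nat mulr2n opprD addNKr.
Qed.

Definition abasis : r.-tuple V := [tuple alpha i | i < r].

Lemma abasisP : basis_of fullv abasis.
Proof. exact: alpha_basis. Qed.

Lemma abasis_nth (i : 'I_r) : abasis`_i = alpha i.
Proof. by rewrite -tnth_nth tnth_mktuple. Qed.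

Definition co i (v : V) : R := coord abasis i v.

Lemma coD i u v : co i (u + v) = co i u + co i v. Proof. exact: raddfD. Qed.
Lemma coN i u : co i (- u) = - co i u. Proof. exact: raddfN. Qed.
Lemma coZ i k u : co i (k *: u) = k * co i u. Proof. exact: linearZ. Qed.
Lemma co0 i : co i 0 = 0. Proof. exact: raddf0. Qed.

Lemma coE v : v = \sum_i co i v *: alpha i.
Proof.
rewrite {1}(coord_basis abasisP (memvf v)).
by apply: eq_bigr => i _; rewrite abasis_nth.
Qed.

Lemma co_sum (x : 'I_r -> R) j : co j (\sum_i x i *: alpha i) = x j.
Proof.
rewrite -[RHS](coord_sum_free x j (basis_free abasisP)); congr coord.
by apply: eq_bigr => i _; rewrite abasis_nth.
Qed.

Lemma co_alpha i j : co i (alpha j) = (i == j)%:R.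
Proof.
rewrite eq_sym /co -abasis_nth coord_free 1?eq_sym //; exact: basis_free abasisP.
Qed.

Lemma co_inj u v : (forall i, co i u = co i v) -> u = v.
Proof. by move=> H; rewrite (coE u) (coE v); apply: eq_bigr => i _; rewrite H. Qed.

Lemma natcombP v : (exists n : 'I_r -> nat, v = \sum_i alpha i *+ n i) <->
  (forall i, co i v \is a Num.nat).
Proof.
split=> [[n ->] j|H].
  have -> : \sum_i alpha i *+ n i = \sum_i (n i)%:R *: alpha i.
    by apply: eq_bigr => i _; rewrite scaler_nat.
  by rewrite co_sum; apply: natr_nat.
have [n nE] : exists n : 'I_r -> nat, forall i, co i v = (n i)%:R.
  by exists (fun i => Num.truncn (co i v)) => i; rewrite truncnK.
by exists n; rewrite {1}(coE v); apply: eq_bigr => i _; rewrite nE scaler_nat.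
Qed.

Lemma dominanceP x y : dominance D x y <-> forall i, co i (y - x) \is a Num.nat.
Proof. exact: natcombP. Qed.

Lemma pos_rootP b : pos_root b <->
  b \in Phi /\ forall i, co i b \is a Num.nat.
Proof.
split=> -[Hb H]; split=> //; last by apply/dominanceP => i; rewrite subr0.
by move/dominanceP: H => H i; have := H i; rewrite subr0.
Qed.

Lemma root_sign b : b \in Phi -> pos_root b \/ pos_root (- b).
Proof.
move=> Hb; have [n [E|E]] := alpha_pos_or_neg Hb; [left|right].
  by apply/pos_rootP; split=> //; apply/natcombP; exists n.
apply/pos_rootP; split; first exact: root_opp.
by apply/natcombP; exists n; rewrite E opprK.
Qed.

Lemma root_neq0 b : b \in Phi -> b <> 0.
Proof. by move=> /Phi_neq0/eqP. Qed.

Lemma pos_root_excl b : pos_root b -> ~ pos_root (- b).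
Proof.
move=> /pos_rootP [Hb Hn] /pos_rootP [_ Hn'].
apply: (root_neq0 Hb); apply: co_inj => i; rewrite co0.
have := natr_ge0 (Hn i); have := natr_ge0 (Hn' i); rewrite coN.
by move=> h1 h2; lra.
Qed.

Lemma alpha_pos i : pos_root (alpha i).
Proof.
apply/pos_rootP; split=> [|j]; first exact: alpha_Phi.
by rewrite co_alpha; apply: natr_nat.
Qed.

Lemma theta_above b : b \in Phi -> forall i, co i (theta - b) \is a Num.nat.
Proof. by move=> /theta_max; move/natcombP. Qed.

(** Otherwise [- theta] would be a positive root that exceeds the maximal
    root. *)
Lemma theta_pos : pos_root theta.
Proof.
case: (root_sign (theta_Phi D)) => // /pos_rootP [HN Hn].
case: (root_neq0 (theta_Phi D)); apply: co_inj => i; rewrite co0.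
have := natr_ge0 (Hn i); have := natr_ge0 (theta_above HN i).
by rewrite coD opprK coN => h1 h2; lra.
Qed.

Lemma rank_gt0 : (0 < r)%N.
Proof.
rewrite lt0n; apply/eqP => r0; apply: (root_neq0 (theta_Phi D)).
by apply/rowP => i; exfalso; move: i; rewrite r0 => -[].
Qed.

(** * Labels of finite and affine roots *)

Local Notation L := (V * R^o)%type.

Definition lrefl (b a : L) : L := a - dot a.1 b.1 *: b.

(** The label [(b, j)] stands for the root [b + j delta]; the finite root
    system consists of the labels with [j = 0]. *)
Definition lroot (aff : bool) : set L :=
  [set a | [/\ a.1 \in Phi, a.2 \is a Num.int & aff || (a.2 == 0)]].

Definition lpos : set L :=
  [set a | 0 < a.2 \/ (a.2 = 0 /\ pos_root a.1)].

(** [sroot None] is the label of [alpha_0 = delta - theta]. *)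
Definition sroot (o : option 'I_r) : L :=
  if o is Some i then (alpha i, 0) else (- theta, 1).

Definition lsimple (aff : bool) : set L :=
  [set a | exists2 o : option 'I_r, aff || (o != None) & a = sroot o].

(** The coordinates of a label on the simple roots: the affine node has finite
    part [- theta], which adding [a.2] times [theta] removes. *)
Definition cf (o : option 'I_r) (a : L) : R :=
  if o is Some i then co i (a.1 + (a.2 : R) *: theta) else a.2.

Lemma cfD o a b : cf o (a + b) = cf o a + cf o b.
Proof.
case: o => [i|] //=; rewrite -coD; congr co.
by rewrite scalerDl addrACA.
Qed.

Lemma cfZ o k a : cf o (k *: a) = k * cf o a.
Proof.
case: o => [i|] //=; rewrite -coZ; congr co.
by rewrite scalerDr scalerA.
Qed.

Lemma cfN o a : cf o (- a) = - cf o a.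
Proof. by rewrite -scaleN1r cfZ mulN1r. Qed.

Lemma cf_sroot o o' : cf o (sroot o') = (o == o')%:R.
Proof.
case: o o' => [i|] [j|] //=; first by rewrite scale0r addr0 co_alpha.
by rewrite scale1r addNr co0.
Qed.

Lemma big_option (M : nmodType) (E : option 'I_r -> M) :
  \sum_o E o = E None + \sum_i E (Some i).
Proof.
rewrite (bigD1 None) //=; congr (_ + _).
rewrite (reindex_omap Some id) /=; last by case.
by apply: eq_bigl => i; rewrite eqxx.
Qed.

Lemma cfE a : a = \sum_o cf o a *: sroot o.
Proof.
rewrite big_option; set S := \sum_i _.
have S1 : S.1 = a.1 + (a.2 : R) *: theta.
  rewrite [RHS]coE /S; apply: (big_morph (fun b : L => b.1)) => //.
have S2 : S.2 = 0.
  by rewrite /S; elim/big_rec: _ => // i x _ /= ->; rewrite scaler0 addr0.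
have E1 : a.1 = (cf None a *: sroot None + S).1.
  rewrite -[RHS]/((a.2 : R) *: - theta + S.1) S1.
  by rewrite scalerN addrCA addNr addr0.
have E2 : a.2 = (cf None a *: sroot None + S).2.
  by rewrite -[RHS]/(a.2 * 1 + S.2) S2 mulr1 addr0.
by rewrite [LHS]surjective_pairing [RHS]surjective_pairing -E1 -E2.
Qed.

Lemma lroot_affine aff a : lroot aff a -> lroot true a.
Proof. by case=> Ha Hj _; split. Qed.

Lemma lroot_opp aff a : lroot aff a -> lroot aff (- a).
Proof.
by move=> [Ha Hj aj]; split; rewrite /= ?oppr_eq0 // ?rpredN //; apply: root_opp.
Qed.

Lemma lroot_refl aff a b : lroot aff a -> lroot aff b -> lroot aff (lrefl b a).
Proof.
move=> [Ha Hj aj] [Hb Hk bk]; split; first exact: root_reflect.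
  rewrite /= rpredB // rpredM //; exact: int_dot_root.
case: aff aj bk => //= /eqP -> /eqP ->.
by rewrite scaler0 subr0.
Qed.

Lemma lrefl_self aff a : lroot aff a -> lrefl a a = - a.
Proof.
by move=> [Ha _ _]; rewrite /lrefl dot_root // scaler_nat mulr2n opprD addNKr.
Qed.

Lemma lreflN a b : lrefl b (- a) = - lrefl b a.
Proof. by rewrite /lrefl dotNl scaleNr opprD. Qed.

Lemma lpos_sign aff a : lroot aff a -> lpos a \/ lpos (- a).
Proof.
case=> Ha _ _; have [j0|j0|j0] := ltrgtP (a.2 : R) 0.
- by right; left; rewrite oppr_gt0.
- by left; left.
- case: (root_sign Ha) => ?; [left|right]; right; split=> //.
  by rewrite /= j0 oppr0.
Qed.

(** A positive label with nonzero [j] is the sum of [theta + b], which is a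
    nonnegative combination since [theta] is maximal, and of [j - 1] times
    [theta]. *)
Lemma cf_nat aff a : lroot aff a -> lpos a -> forall o, cf o a \is a Num.nat.
Proof.
case=> Ha Hj _ Pa.
have a2 : a.2 \is a Num.nat.
  by rewrite natrEint Hj /=; case: Pa => [/ltW //|[-> _]].
case=> [i|] //=; case: Pa => [j0|[-> /pos_rootP [_ Hn]]]; last first.
  by rewrite scale0r addr0.
have -> : a.1 + (a.2 : R) *: theta = (theta - - a.1) + (a.2 - 1 : R) *: theta.
  by apply/rowP => k; rewrite !mxE; ring.
rewrite coD coZ; apply: rpredD; first exact/theta_above/root_opp.
apply: rpredM.
  rewrite natrEint rpredB ?rpred1 //= subr_ge0.
  by have := norm_intr_ge1 Hj (lt0r_neq0 j0); rewrite gtr0_norm.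
by have /pos_rootP [_ ->] := theta_pos.
Qed.

Lemma lpos_cf aff a o : lroot aff a -> 0 < cf o a -> lpos a.
Proof.
move=> Ra fo; case: (lpos_sign Ra) => // Pa.
have := natr_ge0 (cf_nat (lroot_opp Ra) Pa o); rewrite cfN oppr_ge0.
by move=> /(lt_le_trans fo); rewrite ltxx.
Qed.

Lemma lpos_excl aff a : lroot aff a -> lpos a -> ~ lpos (- a).
Proof.
move=> Ra Pa Na; case: (Ra) => Ha _ _; apply: (root_neq0 Ha).
suff -> : a = 0 by [].
rewrite (cfE a) big1 // => o _.
have := natr_ge0 (cf_nat Ra Pa o); have := natr_ge0 (cf_nat (lroot_opp Ra) Na o).
by rewrite cfN => h1 h2; have -> : cf o a = 0 by [lra]; rewrite scale0r.
Qed.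

Lemma sroot_root aff o : aff || (o != None) -> lroot aff (sroot o).
Proof.
case: o => [i|] /=; first by split; rewrite /= ?eqxx ?orbT //; apply: alpha_Phi.
by rewrite orbF => ->; split=> //=; apply: root_opp; apply: theta_Phi.
Qed.

Lemma sroot_pos o : lpos (sroot o).
Proof.
by case: o => [i|]; [right; split=> //; apply: alpha_pos|left; rewrite /= ltr01].
Qed.

Lemma cf_dot (a b : L) : dot a.1 b.1 = \sum_o cf o a * dot (sroot o).1 b.1.
Proof.
have -> : a.1 = \sum_o cf o a *: (sroot o).1.
  by rewrite {1}(cfE a); apply: (big_morph (fun b : L => b.1)).
by rewrite dot_suml; apply: eq_bigr => o _; rewrite dotZl.
Qed.

(** A positive root other than the simple root [c] has a positive coordinate
    away from [c], because the multiples of [c] that are roots are [c] and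
    [- c]; the reflection in [c] does not change this coordinate. *)
Lemma lsimple_perm aff c a : lsimple aff c -> lroot aff a -> lpos a -> a <> c ->
  lpos (lrefl c a).
Proof.
move=> [o affo ->] Ra Pa ac.
have Rs := sroot_root affo; have Rsa := lroot_refl Ra Rs.
have [[o' oo' fo']|no] := pselect (exists2 o', o' != o & cf o' a != 0).
  apply: (lpos_cf (o := o') Rsa).
  rewrite /lrefl cfD cfN cfZ cf_sroot (negPf oo') mulr0 subr0.
  by rewrite natr_gt0 //; exact: (cf_nat Ra Pa).
have aE : a = cf o a *: sroot o.
  rewrite {1}(cfE a) (bigD1 o) //= big1 ?addr0 // => o' oo'.
  have [->|f0] := eqVneq (cf o' a) 0; first by rewrite scale0r.
  by case: no; exists o'.
case: ac; rewrite aE; suff -> : cf o a = 1 by rewrite scale1r.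
have f0 := natr_ge0 (cf_nat Ra Pa o).
case: Ra => Ha _ _; case: (Rs) => Hs _ _.
have := dot_root Ha; rewrite {1 2}aE /= dotZl dotZr dot_root // => E.
by nra.
Qed.

Definition height (a : L) : R := \sum_o cf o a.

Lemma heightB a b (k : R) : height (a - k *: b) = height a - k * height b.
Proof.
rewrite /height mulr_sumr -sumrB; apply: eq_bigr => o _.
by rewrite cfD cfN cfZ.
Qed.

Lemma height_sroot o : height (sroot o) = 1.
Proof.
rewrite /height (bigD1 o) //= cf_sroot eqxx big1 ?addr0 // => o' /negPf oo'.
by rewrite cf_sroot oo'.
Qed.

Lemma height_nat aff a : lroot aff a -> lpos a -> height a \is a Num.nat.
Proof. by move=> Ra Pa; apply: rpred_sum => o _; exact: (cf_nat Ra Pa). Qed.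

Lemma height_gt0 aff a : lroot aff a -> lpos a -> 0 < height a.
Proof.
move=> Ra Pa; rewrite natr_gt0; last exact: (height_nat Ra Pa).
rewrite psumr_neq0; last by move=> o _; apply: natr_ge0; exact: (cf_nat Ra Pa).
apply: contrapT => /negP/hasPn H; case: (Ra) => Ha _ _; apply: (root_neq0 Ha).
suff -> : a = 0 by [].
rewrite (cfE a) big1 // => o _.
have := H o (mem_index_enum _); rewrite andTb natr_gt0; last exact: (cf_nat Ra Pa).
by rewrite negbK => /eqP ->; rewrite scale0r.
Qed.

Lemma lroot_pairing aff a b : lroot aff a -> lroot aff b -> 0 < dot a.1 b.1 ->
  1 <= dot a.1 b.1.
Proof.
move=> [Ha _ _] [Hb _ _] d0.
by have := norm_intr_ge1 (int_dot_root Ha Hb) (lt0r_neq0 d0); rewrite gtr0_norm.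
Qed.

(** As [(a, a) > 0], some simple root with a positive coefficient in [a] pairs
    positively with [a]. *)
Lemma descent aff a : lroot aff a -> lpos a -> ~ lsimple aff a ->
  exists c, [/\ lsimple aff c, 1 <= dot a.1 c.1 & lpos (lrefl c a)].
Proof.
move=> Ra Pa nS.
have [[o affo d0]|no] :=
    pselect (exists2 o, aff || (o != None) & 0 < dot a.1 (sroot o).1).
  have So : lsimple aff (sroot o) by exists o.
  exists (sroot o); split=> //.
    exact: (lroot_pairing Ra (sroot_root affo)).
  by apply: (lsimple_perm So Ra Pa) => aE; apply: nS; rewrite aE.
suff : dot a.1 a.1 <= 0.
  by case: Ra => Ha _ _; rewrite dot_root // leNgt ltr0n.
rewrite cf_dot; apply: sumr_le0 => o _.
have f0 := natr_ge0 (cf_nat Ra Pa o).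
have [affo|] := boolP (aff || (o != None)).
  rewrite mulr_ge0_le0 // dotC leNgt; apply/negP => d0.
  by apply: no; exists o.
rewrite negb_or negbK => /andP [/negPf aff0 /eqP ->] /=.
by case: Ra => _ _; rewrite aff0 => /eqP ->; rewrite mul0r.
Qed.

Lemma label_ind aff (P : L -> Prop) :
  (forall c, lsimple aff c -> P c) ->
  (forall a c, lsimple aff c -> lroot aff a -> lpos a -> lpos (lrefl c a) ->
     P (lrefl c a) -> P a) ->
  forall a, lroot aff a -> lpos a -> P a.
Proof.
move=> base step a Ra Pa.
have /natrP [n hn] := height_nat Ra Pa.
elim/ltn_ind: n a Ra Pa hn => n IH a Ra Pa hn.
have [Sa|nS] := pselect (lsimple aff a); first exact: base.
have [c [Sc d1 Pc]] := descent Ra Pa nS.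
apply: (step _ c) => //.
have Rc : lroot aff c by case: Sc => o affo ->; apply: sroot_root.
have Rca := lroot_refl Ra Rc.
have /natrP [m hm] := height_nat Rca Pc.
apply: (IH m) => //.
have hc : height c = 1 by case: Sc => o _ ->; apply: height_sroot.
by rewrite -(ltr_nat R) -hm -hn heightB hc; lra.
Qed.

Lemma labelsP aff : root_labels (lroot aff) lpos (lsimple aff) lrefl.
Proof.
split.
- exact: lroot_opp.
- by move=> a b Ra Rb; apply: lroot_refl.
- by move=> a b; apply: lreflN.
- exact: lrefl_self.
- exact: lpos_sign.
- by move=> c [o affo ->]; split; [apply: sroot_root|apply: sroot_pos].
- exact: lsimple_perm.
- exact: label_ind.
Qed.

(** A positive root [a] whose reflection keeps all other positive roots positive
   is simple: otherwise some simple [c] would have [a - kc] and [c - ka] both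
   positive for some [k >= 1]. *)
Lemma lsimple_of_perm aff a : lroot aff a -> lpos a ->
  (forall b, lroot aff b -> lpos b -> b <> a -> lpos (lrefl a b)) ->
  lsimple aff a.
Proof.
move=> Ra Pa perm; have [//|nS] := pselect (lsimple aff a).
have [c [Sc d1 Pc]] := descent Ra Pa nS.
have [o affo cE] := Sc.
have Rc : lroot aff c by rewrite cE; apply: sroot_root.
have Pac : lpos (lrefl a c).
  apply: perm => //; first by rewrite cE; apply: sroot_pos.
  by move=> ca; apply: nS; rewrite -ca.
have := height_gt0 (lroot_refl Ra Rc) Pc.
have := height_gt0 (lroot_refl Rc Ra) Pac.
have hc : height c = 1 by rewrite cE; apply: height_sroot.
rewrite !heightB hc (dotC c.1) => h1 h2; by nra.
Qed.

(** * The half sum of the positive roots *)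

Local Notation rho := (frho D).

(** The reflection in [alpha i] permutes the positive roots other than
    [alpha i], hence changes the sum of the positive roots by [2 alpha i]. *)
Lemma rho_alpha i : dot rho (alpha i) = 1.
Proof.
set P := fun b : V => `[< pos_root b >] && (b != alpha i).
set s := fun b : V => b - dot b (alpha i) *: alpha i.
have Ha := alpha_Phi D i.
have sK : involutive s.
  move=> b; rewrite /s dotDl dotNl dotZl dot_root //.
  rewrite [X in _ - X](_ : _ = - (dot b (alpha i) *: alpha i)) ?opprK ?subrK //.
  by rewrite -scaleNr; congr (_ *: _); ring.
have sP b : b \in Phi -> P b -> (s b \in Phi) && P (s b).
  move=> Hb /andP [/asboolP Pb ba]; have Hs := root_reflect Hb Ha.
  have lb : lroot false ((b, 0) : L) by split; rewrite //= ?eqxx.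
  have la : lsimple false (sroot (Some i)) by exists (Some i).
  have bs : ((b, 0) : L) <> sroot (Some i) by move=> [/eqP E]; rewrite E in ba.
  have Pb' : lpos ((b, 0) : L) by right.
  have Ps : pos_root (s b).
    have [|[_ //]] := lsimple_perm la lb Pb' bs.
    by rewrite /= scaler0 subr0 ltxx.
  rewrite Hs; apply/andP; split=> //; apply/andP; split; first exact/asboolP.
  apply/eqP => E; apply: (pos_root_excl (alpha_pos i)).
  suff <- : b = - alpha i by [].
  rewrite -(sK b) E /s dot_root // scaler_nat mulr2n opprD addrA subrr add0r.
  by [].
have sum0 : \sum_(b <- Phi | P b) dot b (alpha i) = 0.
  set T := \sum_(b <- _ | _) _.
  suff : T = - T by move=> ?; lra.
  rewrite {1}/T -big_filter.
  have perm : perm_eq [seq b <- Phi | P b] (map s [seq b <- Phi | P b]).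
    apply: uniq_perm; first by rewrite filter_uniq //; apply: fset_uniq.
      rewrite map_inj_uniq ?filter_uniq //; last exact: inv_inj sK.
      exact: fset_uniq.
    move=> b; apply/idP/mapP => [|[c]]; rewrite !mem_filter.
      move=> /andP [Pb Hb]; exists (s b); rewrite ?sK // mem_filter andbC.
      exact: sP.
    by move=> /andP [Pc Hc] ->; rewrite andbC; apply: sP.
  rewrite (perm_big _ perm) big_map big_filter -sumrN.
  apply: eq_bigr => b _; rewrite /s dotDl dotNl dotZl dot_root //; ring.
rewrite /frho dotZl dot_suml.
rewrite (bigID (fun b => b == alpha i)) /= -[X in _ + X]/(\sum_(b <- Phi | P b) dot b (alpha i)) sum0 addr0.
rewrite (eq_bigl (pred1 (alpha i))); last first.
  move=> b /=; case: eqP => [->|_]; rewrite ?andbF // andbT.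
  by apply/asboolP; apply: alpha_pos.
rewrite -big_filter filter_pred1_uniq ?fset_uniq ?Ha // big_seq1.
by rewrite dot_root // mulVf // pnatr_eq0.
Qed.

Lemma dot_co x b : dot x b = \sum_i co i b * dot x (alpha i).
Proof.
rewrite dotC {1}(coE b) dot_suml; apply: eq_bigr => i _.
by rewrite dotZl dotC.
Qed.

Lemma rho_root b : dot rho b = \sum_i co i b.
Proof. by rewrite dot_co; apply: eq_bigr => i _; rewrite rho_alpha mulr1. Qed.

Lemma int_rho b : b \in Phi -> dot rho b \is a Num.int.
Proof.
have pos a : pos_root a -> dot rho a \is a Num.int.
  move=> /pos_rootP [_ Hn]; rewrite rho_root; apply: rpred_sum => i _.
  exact: intr_nat.
move=> /root_sign [/pos //|/pos]; by rewrite dotNr rpredN.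
Qed.

Lemma dcoxE : dcox D = 1 + dot rho theta.
Proof. by rewrite /dcox cpair_root //; apply: theta_Phi. Qed.

Lemma rho_theta_ge0 : 0 <= dot rho theta.
Proof.
rewrite rho_root; apply: sumr_ge0 => i _; apply: natr_ge0.
by have /pos_rootP [_ ->] := theta_pos.
Qed.

(** * Linear realizations of the labels *)

(** A realization is obtained from functions that are linear in the label and
    from directions [d a] along which the reflections move points, provided that
    the shift along [d b] changes [f a] by the pairing of the finite parts. *)
Section LinearRealization.
Variables (F : numFieldType) (X : lmodType F) (emb : {rmorphism R -> F}).
Variables (aff : bool) (d : L -> X) (f : L -> X -> F) (x0 : X).
Hypothesis dD : forall a b k, d (a + k *: b) = d a + emb k *: d b.
Hypothesis fD : forall a b k x, f (a + k *: b) x = f a x + emb k * f b x.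
Hypothesis f_shift : forall a b x t,
  f a (x - t *: d b) = f a x - t * emb (dot a.1 b.1).
Hypothesis df_inj : forall a b, lroot aff a -> lroot aff b ->
  d a = d b -> f a =1 f b -> a = b.
Hypothesis f_simple : forall c, lsimple aff c -> 0 < f c x0.

Definition lin_refl a x : X := x - f a x *: d a.

Lemma d_zero : d 0 = 0.
Proof. by have := dD 0 0 (-1); rewrite scaleN1r subrr rmorphN1 scaleN1r subrr. Qed.

Lemma d_opp a : d (- a) = - d a.
Proof. by have := dD 0 a (-1); rewrite d_zero !add0r rmorphN1 !scaleN1r. Qed.

Lemma f_zero x : f 0 x = 0.
Proof. by have := fD 0 0 (-1) x; rewrite scaleN1r subrr rmorphN1 mulN1r subrr. Qed.

Lemma f_opp a x : f (- a) x = - f a x.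
Proof. by have := fD 0 a (-1) x; rewrite f_zero !add0r rmorphN1 scaleN1r mulN1r. Qed.

Lemma f_cone a x : f a x = \sum_o emb (cf o a) * f (sroot o) x.
Proof.
rewrite {1}(cfE a); elim/big_rec2: _ => [|o y b _ <-]; first exact: f_zero.
by rewrite addrC fD addrC.
Qed.

Lemma f_lrefl a b x : f (lrefl b a) x = f a x - emb (dot a.1 b.1) * f b x.
Proof. by rewrite /lrefl -scaleNr fD rmorphN mulNr. Qed.

Lemma d_lrefl a b : d (lrefl b a) = d a - emb (dot a.1 b.1) *: d b.
Proof. by rewrite /lrefl -scaleNr dD rmorphN scaleNr. Qed.

Lemma f_refl a b x : f a (lin_refl b x) = f (lrefl b a) x.
Proof. by rewrite f_shift f_lrefl mulrC. Qed.

Lemma lin_reflN a : lin_refl (- a) = lin_refl a.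
Proof. by apply/funext => x; rewrite /lin_refl f_opp d_opp scalerN scaleNr opprK. Qed.

Lemma lin_reflK a : lroot aff a -> lin_refl a \o lin_refl a = id.
Proof.
move=> Ra; apply/funext => x; rewrite /= {1}/lin_refl f_refl (lrefl_self Ra).
by rewrite f_opp scaleNr opprK /lin_refl subrK.
Qed.

Lemma lin_refl_shift a b x s :
  lin_refl b (x - s *: d a) = lin_refl b x - s *: d (lrefl b a).
Proof.
rewrite /lin_refl f_shift d_lrefl (dotC b.1) scalerBl scalerBr scalerA.
by rewrite !opprB addrACA [RHS]addrACA; congr (_ + _); rewrite addrC.
Qed.

Lemma lin_refl_conj a b : lroot aff a -> lroot aff b ->
  lin_refl (lrefl b a) = lin_refl b \o lin_refl a \o lin_refl b.
Proof.
move=> Ra Rb; apply/funext => x; rewrite /= {3}/lin_refl lin_refl_shift.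
rewrite -[lin_refl b (lin_refl b x)]/((lin_refl b \o lin_refl b) x) lin_reflK //.
by rewrite f_refl.
Qed.

(** Two roots with the same reflection pair to [2] or [- 2]. *)
Lemma lin_refl_inj a b : lroot aff a -> lroot aff b -> f a x0 != 0 ->
  lin_refl a = lin_refl b -> a = b \/ a = - b.
Proof.
move=> Ra Rb fa0 E; have [[Ha _ _] [Hb _ _]] := (Ra, Rb).
set p := dot a.1 b.1.
have Ea x : 2 * f a x = f b x * emb p.
  have := congr1 (fun h => f a (h x)) E.
  rewrite /= /lin_refl !f_shift dot_root // rmorph_nat.
  by move/addrI/oppr_inj => <-; rewrite mulrC.
have Eb x : 2 * f b x = f a x * emb p.
  have := congr1 (fun h => f b (h x)) E.
  rewrite /= /lin_refl !f_shift dot_root // rmorph_nat (dotC b.1).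
  by move/addrI/oppr_inj => ->; rewrite mulrC.
have p2 : p ^+ 2 = 2 ^+ 2.
  apply: (fmorph_inj emb); apply: (mulfI fa0).
  rewrite !rmorphXn /= rmorph_nat [in LHS]expr2 mulrA -Eb -mulrA -Ea; ring.
have two : (2 : F) != 0 by rewrite pnatr_eq0.
have dab c : lroot aff c -> lin_refl a = lin_refl c -> f a =1 f c -> a = c.
  move=> Rc Ec fac; apply: df_inj => //.
  have := congr1 (fun h => h x0) Ec; rewrite /lin_refl -fac.
  by move/addrI/oppr_inj/(scalerI fa0).
move/eqP: p2; rewrite eqf_sqr => /orP [] /eqP p2; [left|right]; apply: dab => //.
- by move=> x; apply: (mulfI two); rewrite Ea p2 rmorph_nat mulrC.
- exact: lroot_opp.
- by rewrite lin_reflN.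
- by move=> x; apply: (mulfI two); rewrite Ea p2 rmorphN rmorph_nat f_opp !mulrN mulrC.
Qed.

Lemma lin_f_pos a : lroot aff a -> lpos a -> 0 < f a x0.
Proof.
move=> Ra Pa; have hpos := height_gt0 Ra Pa; rewrite f_cone.
have ge o : 0 <= emb (cf o a) * f (sroot o) x0.
  have [affo|] := boolP (aff || (o != None)).
    have /natrP [n ->] := cf_nat Ra Pa o.
    by rewrite rmorph_nat mulr_ge0 ?ler0n // ltW //; apply: f_simple; exists o.
  rewrite negb_or negbK => /andP [/negPf aff0 /eqP ->] /=.
  by case: Ra => _ _; rewrite aff0 => /eqP ->; rewrite rmorph0 mul0r.
rewrite lt_neqAle sumr_ge0 // andbT eq_sym psumr_neq0 //.
apply: contraTT hpos => /hasPn H; rewrite -leNgt /height sumr_le0 // => o _.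
have {H} := H o (mem_index_enum _); rewrite andTb.
have /natrP [n hn] := cf_nat Ra Pa o; rewrite hn rmorph_nat.
have [affo|] := boolP (aff || (o != None)).
  by case: n {hn} => // n; rewrite mulr_gt0 ?ltr0n //; apply: f_simple; exists o.
rewrite negb_or negbK => /andP [/negPf aff0 /eqP oE].
by move: hn; rewrite oE /=; case: Ra => _ _; rewrite aff0 => /eqP -> <-.
Qed.

Lemma linear_realization :
  realization (lroot aff) lpos lrefl f lin_refl x0.
Proof.
split=> //.
- exact: f_opp.
- by move=> a b x _ _; apply: f_refl.
- by move=> a _; apply: lin_reflN.
- exact: lin_reflK.
- exact: lin_refl_conj.
- move=> a b Ra Rb; apply: lin_refl_inj => //.
  case: (lpos_sign Ra) => Pa; first by rewrite gt_eqF //; apply: lin_f_pos.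
  by rewrite -oppr_eq0 -f_opp gt_eqF //; apply: lin_f_pos => //; apply: lroot_opp.
- exact: lin_f_pos.
Qed.

End LinearRealization.

End Roots.

(** * Alcoves and the group W_e *)

Section FiniteSide.
Variables (R : realType) (r : nat) (D : root_datum R r) (e : nat).
Hypothesis e_gt0 : (0 < e)%N.
Local Notation V := 'rV[R]_r.
Local Notation Phi := (Phi D).
Local Notation alpha := (alpha D).
Local Notation theta := (theta D).
Local Notation pos_root := (pos_root D).
Local Notation rho := (frho D).
Local Notation L := (V * R^o)%type.

(** The mirror of the label [(b, j)] is the hyperplane on which
    [<x + rho, b>] takes the value [- j e]. *)
Definition fV (a : L) (x : V) : R := dot (x + rho) a.1 + a.2 * e%:R.

Definition tV (a : L) : V -> V := lin_refl (fun b : L => b.1) fV a.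

Lemma tVE a x : tV a x = x - fV a x *: a.1. Proof. by []. Qed.

Lemma fV_rhoB a y : fV a (y - rho) = dot y a.1 + a.2 * e%:R.
Proof. by rewrite /fV subrK. Qed.

Lemma fV_shift a x v : fV a (x + v) = fV a x + dot v a.1.
Proof. by rewrite /fV addrAC dotDl addrAC. Qed.

Lemma V_realization x0 : (forall c, lsimple D true c -> 0 < fV c x0) ->
  realization (lroot D true) (lpos D) (@lrefl R r) fV tV x0.
Proof.
move=> Hs; apply: (@linear_realization _ _ _ _ _ [the {rmorphism R -> R} of idfun]) => //.
- by move=> a b k x; rewrite /fV /= dotDr dotZr mulrDl addrACA mulrDr mulrA.
- by move=> a b x t; rewrite fV_shift dotNl dotZl (dotC b.1).
- move=> [a j] [b k] Ra Rb /= ab /(_ x0); rewrite /fV /= ab => /addrI.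
  move/mulIf => -> //.
  by rewrite pnatr_eq0 -lt0n.
Qed.

Lemma alcove_simple x : alcove D e x -> forall c, lsimple D true c -> 0 < fV c x.
Proof.
move=> Cx _ [[i|] _ ->]; rewrite /fV /=.
  have /andP [] := Cx _ (alpha_pos D i).
  by rewrite (cpair_root _ (alpha_Phi D i)) mul0r addr0.
have /andP [_] := Cx _ (theta_pos D).
rewrite (cpair_root _ (theta_Phi D)) => h; rewrite dotNr mul1r; lra.
Qed.

(** The point of the alcove at which [x + rho] is a multiple of [rho]: the
    pairing of [rho] with [theta] is one less than the dual Coxeter number. *)
Definition base : V := (e%:R / dcox D) *: rho - rho.

Lemma base_simple c : lsimple D true c -> 0 < fV c base.
Proof.
have g0 := rho_theta_ge0 D; have e0 : 0 < e%:R :> R by rewrite ltr0n.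
have gg : 0 < dcox D by rewrite dcoxE; lra.
case=> [[i|] _ ->]; rewrite fV_rhoB dotZl /=.
  by rewrite rho_alpha mulr1 mul0r addr0 divr_gt0.
rewrite dotNr mul1r mulrN addrC subr_gt0 -mulrA -[ltRHS]mulr1 ltr_pM2l //.
rewrite mulrC ltr_pdivrMr // mul1r dcoxE; lra.
Qed.

Lemma base_realization :
  realization (lroot D true) (lpos D) (@lrefl R r) fV tV base.
Proof. exact: V_realization base_simple. Qed.

Local Notation G := (generated (tV @` lsimple D true)).

Let genE : generated (tV @` lroot D true) = G :=
  generated_roots (labelsP D true) base_realization.

Lemma root_lattice0 : root_lattice D 0.
Proof. by exists (fun=> 0); rewrite big1 // => i _; rewrite mulr0z. Qed.

Lemma root_latticeD x y : root_lattice D x -> root_lattice D y ->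
  root_lattice D (x + y).
Proof.
move=> [m ->] [n ->]; exists (fun i => m i + n i).
by rewrite -big_split; apply: eq_bigr => i _; rewrite mulrzDr.
Qed.

Lemma root_latticeZ k x : k \is a Num.int -> root_lattice D x ->
  root_lattice D (k *: x).
Proof.
move=> /intrP [m ->] [n ->]; exists (fun i => m * n i).
rewrite scaler_sumr; apply: eq_bigr => i _.
by rewrite scaler_int -mulrzA mulrC.
Qed.

Lemma root_lattice_root b : b \in Phi -> root_lattice D b.
Proof.
have pos a : pos_root a -> root_lattice D a.
  case=> _ [n]; rewrite subr0 => ->; exists (fun i => Posz (n i)).
  by apply: eq_bigr => i _.
move=> /[dup] Hb /root_sign [/pos //|/pos H].
by rewrite -[b]opprK -scaleN1r; apply: root_latticeZ => //; rewrite rpredN1.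
Qed.

Lemma int_dot_lattice x b : root_lattice D x -> b \in Phi ->
  dot x b \is a Num.int.
Proof.
move=> [n ->] Hb; rewrite dot_suml; apply: rpred_sum => i _.
rewrite -scaler_int dotZl; apply: rpredM; first exact: intr_int.
exact: (int_dot_root (alpha_Phi D i) Hb).
Qed.

(** The translation by [e b], for a root [b], is the product of the
    reflections with labels [(b, -1)] and [(b, 0)]. *)
Lemma WeE : We D e = G.
Proof.
rewrite -genE; apply/seteqP; split; last first.
  move=> w [n]; elim=> [|m _ v [a [Ha Hj _] <-] _ [u [c [Wu Qc ->]]]].
    exists id, 0; split; [exact: generated_id|exact: root_lattice0|].
    by apply/funext => x; rewrite scaler0 addr0 addrK.
  exists ((fun x => x - cpair x a.1 *: a.1) \o u), (c - (dot c a.1 + a.2) *: a.1); split.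
  - by apply: generated_comp => //; apply: generated_gen; exists a.1.
  - apply: root_latticeD => //; rewrite -scaleNr; apply: root_latticeZ.
      by rewrite rpredN rpredD //; apply: int_dot_lattice.
    exact: root_lattice_root.
  - apply/funext => x /=; rewrite tVE fV_shift /fV subrK (cpair_root _ Ha).
    by rewrite dotZl; apply/rowP => i; rewrite !mxE; ring.
have finite u : weyl D u -> generated (tV @` lroot D true) (fun x => u (x + rho) - rho).
  move=> [n]; elim=> [|m _ v [b Hb ->] _ IH].
    suff -> : (fun x => id (x + rho) - rho) = id by apply: generated_id.
    by apply/funext => x; rewrite addrK.
  have Rb : lroot D true ((b, 0) : L) by split; rewrite //= ?rpred0.
  have := generated_comp (generated_gen (imageP tV Rb)) IH.
  congr (generated _ _); apply/funext => x /=.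
  by rewrite tVE fV_rhoB mul0r addr0 (cpair_root _ Hb) addrAC.
have trans b : b \in Phi ->
    generated (tV @` lroot D true) (fun x => x + e%:R *: b).
  move=> Hb.
  have Rb : lroot D true ((b, 0) : L) by split; rewrite //= ?rpred0.
  have Rb1 : lroot D true ((b, -1) : L) by split; rewrite //= ?rpredN1.
  have := generated_comp (generated_gen (imageP tV Rb1)) (generated_gen (imageP tV Rb)).
  congr (generated _ _); apply/funext => x /=.
  rewrite !tVE /= -scaleNr fV_shift dotZl (dot_root Hb) /fV /=.
  by apply/rowP => i; rewrite !mxE; ring.
have transZ b (m : int) : b \in Phi ->
    generated (tV @` lroot D true) (fun x => x + e%:R *: (b *~ m)).
  move=> Hb; have natZ (n : nat) (c : V) : c \in Phi ->
      generated (tV @` lroot D true) (fun x => x + e%:R *: (c *+ n)).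
    move=> Hc; elim: n => [|n IH].
      suff -> : (fun x => x + e%:R *: (c *+ 0)) = id by apply: generated_id.
      by apply/funext => x; rewrite mulr0n scaler0 addr0.
    have := generated_comp (trans _ Hc) IH.
    congr (generated _ _); apply/funext => x /=.
    by rewrite mulrSr scalerDr addrA.
  case: m => n; first exact: natZ.
  by rewrite NegzE mulrNz -mulNrz; apply: natZ; apply: root_opp.
move=> _ [u [c [Wu [n ->] ->]]].
have Gc : generated (tV @` lroot D true)
    (fun x => x + e%:R *: \sum_i alpha i *~ n i).
  elim/big_rec: _ => [|i y _ IH].
    suff -> : (fun x : V => x + e%:R *: 0) = id by apply: generated_id.
    by apply/funext => x; rewrite scaler0 addr0.
  have := generated_comp (transZ _ (n i) (alpha_Phi D i)) IH.
  congr (generated _ _); apply/funext => x /=.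
  by rewrite scalerDr -addrA [X in x + X]addrC.
exact: generated_comp Gc (finite _ Wu).
Qed.

Lemma hrefl_tV a : a.1 \in Phi -> hrefl D a.1 (- (a.2 * e%:R)) = tV a.
Proof. by move=> Ha; apply/funext => x; rewrite /hrefl (cpair_root _ Ha) opprK. Qed.

Lemma dot_self_eq0 (v : V) : (dot v v == 0) = (v == 0).
Proof.
rewrite /dot psumr_eq0 => [|i _]; last by rewrite -expr2 sqr_ge0.
apply/allP/eqP => [H|-> i _]; last by rewrite mxE mul0r eqxx.
apply/rowP => i; rewrite mxE; apply/eqP.
by have := H i (mem_index_enum _); rewrite /= mulf_eq0 orbb.
Qed.

Lemma hyperplane_fixed v c : v != 0 ->
  hyperplane D v c = [set x | hrefl D v c x = x].
Proof.
move=> v0; apply/seteqP; split=> x; rewrite /= /hyperplane /hrefl /=.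
  by move=> ->; rewrite subrr scale0r subr0.
move/eqP; rewrite -subr_eq0 addrC addKr oppr_eq0 scaler_eq0 (negPf v0) orbF subr_eq0.
by move/eqP.
Qed.

(** Both normals are orthogonal to the differences of points of the hyperplane,
    hence proportional. *)
Lemma hrefl_hyperplane v c v' c' : v != 0 -> v' != 0 ->
  hyperplane D v c = hyperplane D v' c' -> hrefl D v c = hrefl D v' c'.
Proof.
move=> v0 v0' E.
have d0 : dot v v != 0 by rewrite dot_self_eq0.
have d0' : dot v' v' != 0 by rewrite dot_self_eq0.
pose p := (c / 2) *: v.
have on z : cpair z v = 0 -> cpair (p + z) v' = c'.
  move=> zv; have : hyperplane D v c (p + z - rho).
    rewrite /hyperplane /= subrK /cpair dotDl mulrDr mulrDl -/(cpair z v) zv.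
    by rewrite addr0 /p dotZl; field.
  by rewrite E /hyperplane /= subrK.
have pv' : cpair p v' = c' by rewrite -[p]addr0 on // /cpair dot0l mulr0 mul0r.
have orth z : cpair z v = 0 -> dot z v' = 0.
  move=> /on; rewrite /cpair dotDl mulrDr mulrDl -/(cpair p v') pv'.
  rewrite -[RHS]addr0 => /addrI/eqP.
  by rewrite !mulf_eq0 invr_eq0 (negPf d0') pnatr_eq0 /= orbF => /eqP.
have v'E : v' = (dot v v' / dot v v) *: v.
  apply: dot_inj => z; rewrite dotZr.
  have := orth (z - (dot z v / dot v v) *: v).
  rewrite /cpair !dotDl !dotNl !dotZl divfK // subrr mulr0 mul0r.
  by move=> /(_ (erefl _))/eqP; rewrite subr_eq0 => /eqP ->; field.
set k := _ / _ in v'E; have k0 : k != 0.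
  by apply: contraNneq v0' => k0; rewrite v'E k0 scale0r.
have cE : c' = c / k.
  rewrite -pv' /cpair v'E /p !dotZl !dotZr; field; exact/andP.
apply/funext => x; rewrite /hrefl v'E cE /cpair !dotZl !dotZr scalerA.
by congr (_ - _ *: _); field; apply/andP.
Qed.

Lemma fV_opp a x : fV (- a) x = - fV a x.
Proof. by rewrite /fV /= dotNr mulNr opprD. Qed.

Lemma tV_opp a : tV (- a) = tV a.
Proof. by apply/funext => x; rewrite !tVE fV_opp /= scaleNr scalerN opprK. Qed.

Lemma tV_invol a x : a.1 \in Phi -> tV a (tV a x) = x.
Proof.
move=> Ha; rewrite !tVE -scaleNr fV_shift dotZl (dot_root Ha).
by apply/rowP => i; rewrite !mxE; ring.
Qed.

Lemma hrefl_conj b v c : b.1 \in Phi -> v != 0 -> exists v' c', v' != 0 /\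
  tV b \o hrefl D v c \o tV b = hrefl D v' c'.
Proof.
move=> Hb v0; pose v' := v - dot v b.1 *: b.1.
have norm : dot v' v' = dot v v.
  rewrite /v' !(dotDl, dotDr, dotNl, dotNr, dotZl, dotZr) (dot_root Hb) (dotC b.1).
  by ring.
have d0 : dot v v != 0 by rewrite dot_self_eq0.
exists v', (c + 2 * (b.2 * e%:R) * dot b.1 v / dot v v).
split; first by rewrite -dot_self_eq0 norm.
apply/funext => x /=; rewrite [in LHS]/hrefl; set y := tV b x.
have shift s : tV b (y - s *: v) = x - s *: v'.
  have <- : tV b y = x by rewrite /y tV_invol.
  rewrite !tVE -scaleNr fV_shift dotZl /v'.
  by apply/rowP => i; rewrite !mxE; ring.
rewrite shift /hrefl; congr (_ - _ *: _).
rewrite /cpair norm /y tVE /fV addrAC dotDl dotNl dotZl /v' dotDr dotNr dotZr.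
by rewrite (dotC v b.1); field.
Qed.

(** Comparing gradients, [v] is proportional to the root. *)
Lemma hrefl_of_neg a v c : a.1 \in Phi -> v != 0 ->
  (forall x, fV a (hrefl D v c x) = - fV a x) -> hrefl D v c = tV a.
Proof.
move=> Ha v0 neg; set N := dot v v; set k := dot v a.1.
have N0 : N != 0 by rewrite dot_self_eq0.
have sk x : (cpair (x + rho) v - c) * k = 2 * fV a x.
  have := neg x; rewrite /hrefl -scaleNr fV_shift dotZl -/k => E.
  by have := congr1 (fun z => fV a x - z) E; rewrite /= opprD addNKr mulNr !opprK => ->; ring.
have orth z : 2 * dot z v / N * k = 2 * dot z a.1.
  have := sk z; have := sk 0.
  rewrite /cpair /fV !dotDl !dot0l !add0r -/N => E0 Ez.
  have := congr1 (fun t => t - 2 * (dot rho a.1 + a.2 * e%:R)) Ez.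
  rewrite -{1}E0 => {E0 Ez}; set lhs := _ - _; set rhs := _ - _ => E.
  have -> : 2 * dot z v / N * k = lhs by rewrite /lhs; field.
  by rewrite E /rhs; ring.
have k0 : k != 0.
  apply/eqP => k0; have := orth a.1; rewrite k0 mulr0 (dot_root Ha) => /eqP.
  by rewrite eq_sym mulf_eq0 pnatr_eq0.
have vE : v = (N / k) *: a.1.
  apply: dot_inj => z; rewrite dotZr; have := orth z => E.
  have two : (2 : R) != 0 by rewrite pnatr_eq0.
  have -> : dot z v = (2 * dot z v / N * k) * (N / (2 * k)).
    by field; rewrite N0 k0.
  by rewrite E; field.
have kE : k = N / k * 2 by rewrite -(dot_root Ha) -dotZl -vE.
apply/funext => x; rewrite tVE /hrefl {2}vE scalerA; congr (_ - _ *: _).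
apply: (mulIf k0); rewrite -mulrA divfK //.
have -> : (cpair (x + rho) v - c) * N = (cpair (x + rho) v - c) * k * (N / k).
  by field.
by rewrite sk [in RHS]kE; ring.
Qed.

(** By [involution_conj] the reflection is conjugate to an orthogonal
    reflection that negates the function of a simple root. *)
Lemma We_hrefl v c : v != 0 -> We D e (hrefl D v c) ->
  exists2 a, lroot D true a & hrefl D v c = tV a.
Proof.
rewrite WeE => v0 Gg.
pose P : set (V -> V) := [set g | exists v c, v != 0 /\ g = hrefl D v c].
have Pg : P (hrefl D v c) by exists v, c.
have gg : hrefl D v c \o hrefl D v c = id.
  apply/funext => x /=; have d0 : dot v v != 0 by rewrite dot_self_eq0.
  rewrite [in LHS]/hrefl; set s := cpair (x + rho) v - c.
  have -> : cpair (hrefl D v c x + rho) v - c = - s.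
    rewrite /hrefl -/s /cpair addrAC dotDl dotNl dotZl.
    have sE : s = 2 * dot (x + rho) v / dot v v - c by [].
    move: s sE => s sE; transitivity (2 * dot (x + rho) v / dot v v - c - 2 * s).
      by field.
    by rewrite -sE; ring.
  by rewrite /hrefl -/s scaleNr opprK subrK.
have gid : hrefl D v c <> id.
  move=> E; have := congr1 (fun h => h ((c / 2 + 1) *: v - rho)) E.
  rewrite /hrefl /= subrK /cpair dotZl => /eqP.
  rewrite -subr_eq0 addrC addKr oppr_eq0 scaler_eq0 (negPf v0) orbF.
  by apply/negP; rewrite (_ : _ - _ = 2) ?pnatr_eq0 //; field; rewrite dot_self_eq0.
have Pconj b g : lsimple D true b -> G g -> P g -> P (tV b \o g \o tV b).
  move=> /(rl_simple (labelsP D true)) [[Hb _ _] _] _ [v1 [c1 [v10 ->]]].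
  by have [v' [c' [? ?]]] := hrefl_conj c1 Hb v10; exists v', c'.
have [u [w [Gu wu uw [v1 [c1 [v10 hE]]] [b Sb neg]]]] :=
  involution_conj (labelsP D true) base_realization Pconj Gg Pg gg gid.
have [Rb _] := rl_simple (labelsP D true) Sb; have [Hb _ _] := Rb.
have hb : w \o hrefl D v c \o u = tV b.
  rewrite hE; apply: hrefl_of_neg => // x; rewrite -hE; exact: neg.
have [a [Ra _ ta]] := move_root (labelsP D true) base_realization Gu Rb.
exists a => //; apply/funext => x.
have uwE y : u (w y) = y by exact: (congr1 (fun h => h y) uw).
rewrite -[LHS]uwE -{1}[x]uwE -[w _]/((w \o hrefl D v c \o u) (w x)) hb.
by rewrite -[u _]/((u \o tV b) (w x)) -ta /= uwE.
Qed.

Lemma We_tV a : lroot D true a -> We D e (tV a).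
Proof. by move=> Ra; rewrite WeE; apply: (tr_gen (labelsP D true) base_realization). Qed.

Lemma lroot_phi aff a : lroot D aff a -> a.1 \in Phi. Proof. by case. Qed.

Lemma root_neq (a : L) : a.1 \in Phi -> a.1 != 0. Proof. exact: Phi_neq0. Qed.

Lemma hyperplane_tV a : a.1 \in Phi ->
  hyperplane D a.1 (- (a.2 * e%:R)) = [set x | fV a x = 0].
Proof.
move=> Ha; apply/seteqP; split=> x; rewrite /hyperplane /= (cpair_root _ Ha) /fV.
  by move=> ->; rewrite addNr.
by move/eqP; rewrite addr_eq0 => /eqP.
Qed.

Lemma reflecting_hyperplaneP H : reflecting_hyperplane D e H <->
  exists a, [/\ lroot D true a, lpos D a & H = [set x | fV a x = 0]].
Proof.
split=> [[v [c [v0 Wv ->]]]|[a [Ra Pa ->]]]; last first.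
  have Ha := lroot_phi Ra; exists a.1, (- (a.2 * e%:R)); split.
  - exact: root_neq.
  - by rewrite hrefl_tV //; apply: We_tV.
  - by rewrite hyperplane_tV.
have [a [Ra Pa E]] : exists a, [/\ lroot D true a, lpos D a & hrefl D v c = tV a].
  have [a Ra E] := We_hrefl v0 Wv.
  case: (lpos_sign Ra) => Pa; first by exists a.
  by exists (- a); rewrite tV_opp; split=> //; apply: lroot_opp.
have Ha := lroot_phi Ra.
exists a; split=> //; rewrite hyperplane_fixed // E -hrefl_tV //.
by rewrite -hyperplane_fixed ?root_neq // hyperplane_tV.
Qed.

Lemma fV_cone a x : fV a x = \sum_o cf D o a * fV (sroot D o) x.
Proof.
apply: (@f_cone _ _ D _ V [the {rmorphism R -> R} of idfun] fV) => b c k y.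
by rewrite /fV /= dotDr dotZr mulrDl addrACA mulrDr mulrA.
Qed.

(** At a point of a wall some simple root with a positive coefficient in the
    root of this wall vanishes, so the wall is the mirror of this simple root.
    Conversely, the midpoint of [base] and of its image under a simple
    reflection lies on no other mirror and in the closed alcove. *)
Lemma We_simpleE : We_simple D e = tV @` lsimple D true.
Proof.
apply/seteqP; split=> [s|_ [c Sc <-]].
  move=> [v [c [v0 [RH [x [Cx Hx only]]] ->]]].
  have [a [Ra Pa HE]] := (reflecting_hyperplaneP _).1 RH.
  have fx : fV a x = 0 by rewrite HE in Hx.
  have f0 o : 0 <= fV (sroot D o) x.
    case: o => [i|] /=; rewrite /fV /=.
      have := Cx _ (alpha_pos D i); rewrite (cpair_root _ (alpha_Phi D i)).
      by rewrite mul0r addr0 => /andP [].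
    have := Cx _ (theta_pos D); rewrite (cpair_root _ (theta_Phi D)).
    by move=> /andP [_]; rewrite dotNr mul1r => h; lra.
  have t0 o : 0 <= cf D o a * fV (sroot D o) x.
    by apply: mulr_ge0 => //; apply: natr_ge0; exact: (cf_nat Ra Pa).
  have [o co0] : exists o, cf D o a != 0.
    apply: contrapT => no; have := height_gt0 Ra Pa.
    rewrite /height big1 ?ltxx // => o _; apply: contrapT => /eqP co0.
    by apply: no; exists o.
  have fo : fV (sroot D o) x = 0.
    move: fx; rewrite fV_cone => /eqP; rewrite psumr_eq0 // => /allP /(_ o (mem_index_enum _)).
    by rewrite /= mulf_eq0 (negPf co0) => /eqP.
  have Rs : lroot D true (sroot D o) by apply: sroot_root.
  have Ho : reflecting_hyperplane D e [set y | fV (sroot D o) y = 0].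
    by apply/reflecting_hyperplaneP; exists (sroot D o); split=> //; apply: sroot_pos.
  have Eo := only _ Ho fo.
  exists (sroot D o); first by exists o.
  have Hs := lroot_phi Rs; rewrite -hrefl_tV //.
  apply: hrefl_hyperplane => //; first exact: root_neq.
  by rewrite -Eo hyperplane_tV.
have [Rc Pc] := rl_simple (labelsP D true) Sc; have Hc := lroot_phi Rc.
pose x := base - (fV c base / 2) *: c.1.
have fx b : fV b x = (fV b base + fV b (tV c base)) / 2.
  by rewrite /x tVE -!scaleNr !fV_shift !dotZl; field.
have fxc : fV c x = 0.
  by rewrite /x -scaleNr fV_shift dotZl (dot_root Hc); field.
have fxpos b : lroot D true b -> lpos D b -> b <> c -> 0 < fV b x.
  move=> Rb Pb bc; rewrite fx divr_gt0 ?ltr0n // addr_gt0 //.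
    exact: (rz_pos base_realization).
  rewrite (rz_tr base_realization) //; apply: (rz_pos base_realization).
    exact: lroot_refl.
  exact: (lsimple_perm Sc).
have fxge b : lroot D true b -> lpos D b -> 0 <= fV b x.
  move=> Rb Pb; have [->|bc] := pselect (b = c); first by rewrite fxc.
  by apply: ltW; apply: fxpos.
exists c.1, (- (c.2 * e%:R)); split; [exact: root_neq| |by rewrite hrefl_tV].
rewrite hyperplane_tV //; split.
  by apply/reflecting_hyperplaneP; exists c.
exists x; split=> //.
  move=> b Pb; have [Hb _] := Pb; rewrite (cpair_root _ Hb).
  have Rb : lroot D true ((b, 0) : L) by split; rewrite //= rpred0.
  have Rb1 : lroot D true ((- b, 1) : L) by split; rewrite //= ?root_opp ?rpred1.
  have := fxge _ Rb (or_intror (conj erefl Pb)).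
  have P1 : lpos D ((- b, 1) : L) by left; rewrite /= ltr01.
  have := fxge _ Rb1 P1.
  by rewrite /fV /= dotNr mul0r mul1r => h1 h2; apply/andP; split; lra.
move=> H' /reflecting_hyperplaneP [a [Ra Pa ->]] fa.
have [-> //|ac] := pselect (a = c).
by have := fxpos _ Ra Pa ac; rewrite fa ltxx.
Qed.

End FiniteSide.

(** * Bruhat order and linkage of dominant alcoves *)

Section DominantAlcoves.
Variables (R : realType) (r : nat) (D : root_datum R r) (e : nat).
Hypothesis e_gt0 : (0 < e)%N.
Local Notation V := 'rV[R]_r.
Local Notation Phi := (Phi D).
Local Notation alpha := (alpha D).
Local Notation theta := (theta D).
Local Notation pos_root := (pos_root D).
Local Notation rho := (frho D).
Local Notation L := (V * R^o)%type.
Local Notation fV := (fV D e).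
Local Notation tV := (tV D e).
Local Notation lroot := (lroot D true).
Local Notation lpos := (lpos D).
Local Notation lsimple := (lsimple D true).
Local Notation G := (generated (tV @` lsimple)).

Variable lam : V.
Hypotheses (lam_dom : dominant D lam) (lam_alcove : alcove D e lam).

Let rl := labelsP D true.
Let rz : realization lroot lpos (@lrefl R r) fV tV lam :=
  V_realization e_gt0 (alcove_simple lam_alcove).

Local Notation rstep := (rstep lroot fV tV lam).

(** Crossing the mirror of [a] from its positive side adds a positive multiple
    of [- a.1], so this goes up in the dominance order when [- a.1] is
    positive. *)
Definition lneg : set L := [set a | pos_root (- a.1)].

Lemma pos_root_co b : pos_root b -> exists i, 0 < co D i b.
Proof.
move=> /pos_rootP [Hb Hn]; apply: contrapT => no; apply: (root_neq0 Hb).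
apply: (@co_inj _ _ D) => i; rewrite co0; apply: contrapT => /eqP n0.
by apply: no; exists i; rewrite natr_gt0.
Qed.

Lemma weightP x : weight D x <-> forall b, b \in Phi -> dot x b \is a Num.int.
Proof.
split=> H b Hb; have := H b Hb; rewrite ?(cpair_root _ Hb); first by move/is_intP.
by move=> ?; apply/is_intP.
Qed.

Lemma int_fV x a : weight D x -> lroot a -> fV a x \is a Num.int.
Proof.
move=> /weightP Wx [Ha Hj _]; rewrite /fV dotDl; apply: rpredD.
  by apply: rpredD; [apply: Wx|apply: int_rho].
by apply: rpredM => //; apply: natr_int.
Qed.

Lemma weight_gen y x : G y -> weight D x -> weight D (y x).
Proof.
move=> [n Hy] Wx; elim: Hy => [//|m _ v [c Sc <-] _ IH].
have [Rc _] := rl_simple rl Sc; have [Hc _ _] := Rc.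
apply/weightP => b Hb; rewrite /= tVE dotDl dotNl dotZl; apply: rpredB.
  by move/weightP: IH; apply.
by apply: rpredM; [apply: int_fV|apply: int_dot_root Hc Hb].
Qed.

Lemma chain_of_up_e y nu : G y -> up_e D e (y lam) nu ->
  exists w, [/\ G w, nu = w lam & chain (rstep lneg) y w].
Proof.
move=> Gy; elim=> [_|x s _ [w [Gw -> yw]] [Ws [v [c [v0 sE]]]] _ dom].
  by exists y; split=> //; apply: chain_refl.
rewrite sE in Ws dom *.
have [a [Ra Na E]] : exists a, [/\ lroot a, lneg a & hrefl D v c = tV a].
  have [a Ra E] := We_hrefl e_gt0 v0 Ws; have [Ha _ _] := Ra.
  case: (root_sign Ha) => Pa; last by exists a.
  exists (- a); rewrite tV_opp; split=> //; first exact: lroot_opp.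
  by rewrite /lneg /= opprK.
rewrite E in dom *.
have st : rstep lneg w (tV a \o w).
  exists a; split=> //; case: (sign_orbit rl rz Gw Ra) => // fneg.
  have [i ci] := pos_root_co Na.
  move/dominanceP: dom => /(_ i) /natr_ge0.
  rewrite tVE addrC addKr -scalerN coZ => h; exfalso.
  by move: h; rewrite leNgt pmulr_llt0 // fneg.
exists (tV a \o w); split=> //; first exact: (rstep_gen rl rz st).
exact: chain_step st.
Qed.

Lemma up_e_of_chain y w : G y -> chain (rstep lneg) y w ->
  up_e D e (y lam) (w lam).
Proof.
move=> Gy; have [Wlam _] := lam_dom.
elim=> [|x z yx IH st]; first exact: up_e_refl (weight_gen Gy Wlam).
have Gx := chain_gen rl rz yx Gy; have Gz := rstep_gen rl rz st Gx.
have Wz := weight_gen Gz Wlam.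
case: st Wz => a [Ra Na fa ->] /= Wz; have [Ha _ _] := Ra.
apply: up_e_step IH _ Wz _.
  split; first exact: We_tV.
  exists a.1, (- (a.2 * e%:R)); split; first exact: (root_neq Ha).
  by rewrite hrefl_tV.
apply/dominanceP => i; rewrite tVE addrC addKr -scalerN coZ; apply: rpredM.
  by rewrite natrEint (int_fV (weight_gen Gx Wlam) Ra) ltW.
by case/pos_rootP: Na => _; apply.
Qed.

Definition in_chamber (y : V -> V) := forall b, pos_root b -> 0 < dot (y lam + rho) b.

Lemma dominant_in_chamber y : dominant D (y lam) -> in_chamber y.
Proof.
move=> [_ dom] b Pb; rewrite (dot_co D).
have ge1 i : 1 <= dot (y lam + rho) (alpha i).
  have := dom i; rewrite (cpair_root _ (alpha_Phi D i)) dotDl rho_alpha; lra.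
have [j cj] := pos_root_co Pb; case/pos_rootP: Pb => _ Hn.
rewrite (bigD1 j) //=; apply: ltr_pwDl.
  by apply: mulr_gt0 => //; apply: lt_le_trans (ge1 j).
apply: sumr_ge0 => i _; apply: mulr_ge0; first exact: natr_ge0.
by apply: le_trans (ge1 i).
Qed.

(** A right descent of a dominant alcove crosses a mirror that separates it from
    [lam], and the mirrors of the finite roots do not. The label of this mirror
    has positive [j], and negative finite part because it is negative on a
    dominant alcove. *)
Lemma chamber_down v w c : G v -> lsimple c -> w = v \o tV c ->
  rstep lpos v w -> in_chamber w -> in_chamber v /\ rstep lneg v w.
Proof.
move=> Gv Sc wE st dw; have Gw := rstep_gen rl rz st Gv.
case: (st) => a [Ra Pa fa wa]; have [Ha Hj _] := Ra.
have fw : fV a (w lam) < 0.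
  by rewrite wa /= (f_self rl rz) // oppr_lt0.
have e0 : 0 <= e%:R :> R by apply: ler0n.
have Na : pos_root (- a.1).
  case: (root_sign Ha) => // Pa1; have := dw _ Pa1.
  suff h : 0 <= a.2 * e%:R by move=> h'; have := lt_trans (ltr_wpDr h h') fw; rewrite ltxx.
  by apply: mulr_ge0 => //; case: Pa => [/ltW //|[-> _]].
split; last by exists a.
move=> b Pb; have [Hb _] := Pb.
have Rb : lroot ((b, 0) : L) by split; rewrite //= rpred0.
have fb : 0 < fV ((b, 0) : L) (w lam) by rewrite /fV mul0r addr0; apply: dw.
have vE : w \o tV c = v.
  by rewrite wE -compA (rz_trK rz) //; case: (rl_simple rl Sc).
case: (keep_sign rl rz Gw Sc Rb fb) => [|].
  rewrite vE => E.
  have {}E : tV (b, 0) = tV a.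
    have : v = tV a \o w by rewrite wa (trK_app rz).
    rewrite -E => {}E; have [u [_ _ wu]] := gen_inv rl rz Gw.
    by rewrite -[LHS]/(tV (b, 0) \o id) -wu compA E -compA wu.
  case: (rz_inj rz Rb Ra E) => [ab|ab].
    by case: (pos_root_excl (D := D) (b := b)) => //; rewrite [b](congr1 fst ab).
  have a20 : a.2 = 0 by have := congr1 snd ab; move/eqP; rewrite eq_sym oppr_eq0 => /eqP.
  case: Pa => [|[_ Pa1]]; first by rewrite a20 ltxx.
  by case: (pos_root_excl Pa1).
by rewrite -[v]vE /fV mul0r addr0.
Qed.

(** Let [c] be a right descent of [w] and [v = w c], which is dominant and
    linked below [w]. If [y < y c] then [y <= v], and induction applies to [y]
    and [v]. Otherwise it applies to [y c] and [v], and [chain_raise] brings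
    [y c] back to [y]. *)
Lemma bruhat_to_up y w : G y -> in_chamber y -> in_chamber w ->
  chain (rstep lpos) y w -> chain (rstep lneg) y w.
Proof.
move=> Gy dy dw yw; have Gw := chain_gen rl rz yw Gy.
have [n Hw] := Gw; elim/ltn_ind: n y w Gy dy dw yw Gw Hw => n IH y w Gy dy dw yw Gw Hw.
have [[|m] Hm] := has_length_ex Gw.
  have wid := word_nilP (proj1 Hm).
  case: yw wid Hm => [|x z yx st] wid Hm; first by rewrite wid; apply: chain_refl.
  by have [] := rstep_down rl rz st (proj1 Hm).
have mn : (m < n)%N by apply: (proj2 Hm).
have [c [v [Sc Hv wE st]]] := last_letter rl rz Hm.
have Gv : G v by exists m.
have [dv stv] := chamber_down Gv Sc wE st dw.
have Rc : lroot c by case: (rl_simple rl Sc).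
have cc (z : V -> V) : (z \o tV c) \o tV c = z by rewrite -compA (rz_trK rz).
have vE : w \o tV c = v by rewrite wE cc.
case: (right_comparable rl rz Gy Sc) => sty.
  apply: chain_step stv; apply: (IH m) => //.
  by rewrite -vE; apply: (chain_lower rl rz).
have Gyc : G (y \o tV c).
  by apply: generated_comp => //; apply: simple_gen.
have [dyc styc] := chamber_down Gyc Sc (esym (cc y)) sty dy.
rewrite -(cc y). apply: (chain_raise rl rz Gyc Sc); last by rewrite vE.
apply: chain_step stv; apply: (IH m) => //.
rewrite -vE; apply: (chain_lower rl rz) => //; last by rewrite cc.
exact: chain_trans (chain1 sty) yw.
Qed.

(** Twice a multiple of [rho] makes the translation an element of [W_e]. *)
Definition shift (N : nat) (x : V) : V := x + e%:R *: ((N.*2)%:R *: rho).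

Lemma two_rho_lattice : root_lattice D (2 *: rho).
Proof.
rewrite /frho scalerA divff ?pnatr_eq0 // scale1r big_seq_cond.
elim/big_rec: _ => [|b y /andP [Hb _] Qy]; first exact: root_lattice0.
by apply: root_latticeD Qy; apply: root_lattice_root.
Qed.

Lemma shift_gen N : G (shift N).
Proof.
rewrite -WeE //; exists id, ((N.*2)%:R *: rho); split.
- exact: generated_id.
- rewrite -muln2 natrM -scalerA; apply: root_latticeZ; first exact: natr_int.
  exact: two_rho_lattice.
- by apply/funext => x; rewrite addrK.
Qed.

Lemma fV_shiftN N a x : fV a (shift N x) = fV a x + (N.*2)%:R * dot rho a.1 * e%:R.
Proof. by rewrite /shift fV_shift !dotZl; ring. Qed.

Lemma rho_pos b : pos_root b -> 1 <= dot rho b.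
Proof.
move=> Pb; have [Hb _] := Pb; have := norm_intr_ge1 (int_rho Hb).
have g0 : 0 < dot rho b.
  rewrite rho_root; have [j cj] := pos_root_co Pb; case/pos_rootP: Pb => _ Hn.
  by rewrite (bigD1 j) //=; apply: ltr_pwDl => //; apply: sumr_ge0 => i _; apply: natr_ge0.
by rewrite gtr0_norm // gt_eqF // => ->.
Qed.

(** The translation replaces [j] by [j - 2 N <rho, b>], which is positive for
    large [N] since [b] is negative. *)
Lemma chain_shift y w : chain (rstep lneg) y w ->
  exists N0, forall N, (N0 <= N)%N -> chain (rstep lpos) (shift N \o y) (shift N \o w).
Proof.
elim=> [|x z _ [N0 H] [a [Ra Na fa zE]]].
  by exists 0%N => N _; apply: chain_refl.
have [Ha Hj _] := Ra.
exists (maxn N0 (Num.bound `|a.2 : R|)) => N; rewrite geq_max => /andP [N0N bN].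
apply: chain_step (H _ N0N) _.
pose k : R := (N.*2)%:R * dot rho a.1.
have Ik : k \is a Num.int by apply: rpredM; [apply: natr_int|apply: int_rho].
have fk u : fV ((a.1, a.2 - k) : L) (shift N u) = fV a u.
  by rewrite fV_shiftN /fV /= -/k; ring.
exists ((a.1, a.2 - k) : L); split.
- by split=> //=; apply: rpredB.
- left; rewrite /= subr_gt0.
  have := rho_pos Na; rewrite dotNr => h1.
  have h2 : `|a.2 : R| < N%:R.
    apply: lt_le_trans (archi_boundP (normr_ge0 _)) _.
    by rewrite ler_nat.
  have h3 : 0 <= N%:R :> R by apply: ler0n.
  rewrite /k -muln2 natrM.
  have := ler_norm (- (a.2 : R)); rewrite normrN => h4.
  by nra.
- by rewrite /= fk.
- by rewrite zE; apply/funext => u /=; rewrite !tVE fk /shift /= addrAC.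
Qed.

(** A positive root [(b, j)] that is negative on the translate of [lam] has [b]
    negative and is nonpositive at the apex of the translated dominant chamber;
    so it is negative inside this chamber, which contains the translates of all
    dominant alcoves. *)
Lemma up_to_bruhat y w : G y -> G w -> in_chamber y -> in_chamber w ->
  chain (rstep lneg) y w -> chain (rstep lpos) y w.
Proof.
move=> Gy Gw dy dw /chain_shift [N H].
have [n Hn] := has_length_ex (shift_gen N).
apply: (cancel_left rl rz Hn Gy Gw _ (H N (leqnn N))) => a Ra Pa.
have [Ha Hj _] := Ra; rewrite !fV_shiftN /fV.
set k : R := (N.*2)%:R * dot rho a.1 => fa.
have Ik : k \is a Num.int by apply: rpredM; [apply: natr_int|apply: int_rho].
have e0 : 0 < e%:R :> R by rewrite ltr0n.
case: (root_sign Ha) => Pa1.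
  have := lam_alcove Pa1; rewrite (cpair_root _ Ha) => /andP [h1 _].
  have h2 : 0 <= (a.2 : R) by case: Pa => [/ltW //|[-> _]].
  have h3 : 0 <= k by apply: mulr_ge0; [apply: ler0n|have := rho_pos Pa1; lra].
  by exfalso; nra.
have := lam_alcove Pa1; rewrite (cpair_root _ (root_opp Ha)) dotNr => /andP [_ h1].
have h2 : (a.2 : R) + k <= 0.
  have lt1 : (a.2 : R) + k < 1 by nra.
  have /intrP [m hm] : (a.2 : R) + k \is a Num.int by apply: rpredD.
  by move: lt1; rewrite hm -[1]/(1%:~R) ltr_int lerz0 => h; lia.
have := dy _ Pa1; have := dw _ Pa1; rewrite !dotNr => h3 h4.
by split; nra.
Qed.

Lemma dominant_alcove_order y w : We D e y -> We D e w ->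
  dominant D (y lam) -> dominant D (w lam) ->
  (le_e D e y w <-> up_e D e (y lam) (w lam)).
Proof.
rewrite (WeE _ e_gt0) /le_e (We_simpleE _ e_gt0) => Gy Gw dy dw.
have cy := dominant_in_chamber dy; have cw := dominant_in_chamber dw.
split=> [/(bruhatE rl rz) [_ yw]|].
  by apply: up_e_of_chain => //; apply: bruhat_to_up.
move=> /(chain_of_up_e Gy) [w' [Gw' wE yw]].
have ww : w = w' by apply: (regular_inj rl rz).
by apply/(bruhatE rl rz); split=> //; apply: up_to_bruhat => //; rewrite ww.
Qed.

End DominantAlcoves.

(** * Affine roots on the dual of the Cartan subalgebra *)

Section AffineSide.
Variables (R : realType) (r : nat) (D : root_datum R r) (q : nat).
Hypothesis q_gt0 : (0 < q)%N.
Local Notation V := 'rV[R]_r.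
Local Notation Phi := (Phi D).
Local Notation alpha := (alpha D).
Local Notation theta := (theta D).
Local Notation pos_root := (pos_root D).
Local Notation rho := (frho D).
Local Notation arho := (arho D).
Local Notation L := (V * R^o)%type.
Local Notation H := (hdual R r).
Local Notation toC := (real_complex R).
Local Notation lpos := (lpos D).

(** The root [b + k j delta] of the label [(b, j)]: the integral root system of
    a weight contains the real roots whose [delta] part is a multiple of a
    period [k]. *)
Definition cl (k : nat) (a : L) : H := (complexify a.1, 0, toC (k%:R * a.2)).

(** The pairing of [x] with the coroot of [cl q a], in the case that [a.1] is
    a root; this form is linear in [a]. *)
Definition fH (a : L) (x : H) : R[i] :=
  dot (fin x) (complexify a.1) + toC (q%:R * a.2) * lev x.

Definition tH (a : L) : H -> H := lin_refl (cl q) fH a.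

Lemma tHE a x : tH a x = x - fH a x *: cl q a. Proof. by []. Qed.

Lemma finD (x y : H) : fin (x + y) = fin x + fin y. Proof. by []. Qed.
Lemma levD (x y : H) : lev (x + y) = lev x + lev y. Proof. by []. Qed.
Lemma finB (x y : H) k : fin (x - k *: y) = fin x - k *: fin y. Proof. by []. Qed.
Lemma levB (x y : H) k : lev (x - k *: y) = lev x - k * lev y. Proof. by []. Qed.

Lemma complexifyD (u v : V) k :
  complexify (u + k *: v) = complexify u + toC k *: complexify v.
Proof. by apply/rowP => i; rewrite !mxE rmorphD rmorphM. Qed.

Lemma complexify_inj : injective (@complexify R r).
Proof.
by move=> u v /rowP E; apply/rowP => i; have := E i; rewrite !mxE => /complexI.
Qed.

Lemma dot_complexify (u v : V) : dot (complexify u) (complexify v) = toC (dot u v).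
Proof. exact: dot_map. Qed.

Lemma hdual_ext (x y : H) : fin x = fin y -> lev x = lev y -> del x = del y -> x = y.
Proof.
by case: x y => [[? ?] ?] [[? ?] ?]; rewrite /fin /lev /del /= => -> -> ->.
Qed.

Lemma clD k a b (t : R) : cl k (a + t *: b) = cl k a + toC t *: cl k b.
Proof.
have E1 : fin (cl k (a + t *: b)) = fin (cl k a + toC t *: cl k b).
  exact: complexifyD.
have E2 : lev (cl k (a + t *: b)) = lev (cl k a + toC t *: cl k b).
  by rewrite levD -[RHS]/(0 + toC t * 0) mulr0 addr0.
have E3 : del (cl k (a + t *: b)) = del (cl k a + toC t *: cl k b).
  rewrite -[LHS]/(toC (k%:R * (a.2 + t * b.2))).
  rewrite -[RHS]/(toC (k%:R * a.2) + toC t * toC (k%:R * b.2)).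
  by rewrite -rmorphM -rmorphD; congr toC; ring.
exact: hdual_ext.
Qed.

Lemma cl_add k a b : cl k (a + b) = cl k a + cl k b :> H.
Proof. by have := clD k a b 1; rewrite !scale1r. Qed.

Lemma cl_zero k : cl k (0 : L) = 0.
Proof.
by have := clD k (0 : L) 0 (-1); rewrite scaleN1r subrr rmorphN1 scaleN1r subrr.
Qed.

Lemma cl_scaled k (a : L) t : cl k (t *: a) = toC t *: cl k a.
Proof. by have := clD k 0 a t; rewrite cl_zero !add0r. Qed.

Lemma cl_natmul k (a : L) n : cl k (a *+ n) = cl k a *+ n.
Proof. by rewrite -scaler_nat cl_scaled rmorph_nat scaler_nat. Qed.

Lemma cl_inj k : (0 < k)%N -> injective (cl k).
Proof.
move=> k0 [u i] [v j] E.
have /complexify_inj -> : complexify u = complexify v by exact: (congr1 (@fin R r) E).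
have /complexI/mulfI -> // : toC (k%:R * i) = toC (k%:R * j).
  exact: (congr1 (@del R r) E).
by rewrite pnatr_eq0 -lt0n.
Qed.

Lemma fH_shift a b x t :
  fH a (x - t *: cl q b) = fH a x - t * toC (dot a.1 b.1).
Proof.
rewrite /fH finB levB -[lev (cl q b)]/(0 : R[i]) mulr0 subr0.
rewrite dotDl dotNl dotZl dot_complexify (dotC b.1); ring.
Qed.

Lemma fHD a b k x : fH (a + k *: b) x = fH a x + toC k * fH b x.
Proof.
rewrite /fH -[(a + k *: b).1]/(a.1 + k *: b.1) -[(a + k *: b).2]/(a.2 + k * b.2).
rewrite complexifyD dotDr dotZr.
have -> : toC (q%:R * (a.2 + k * b.2)) = toC (q%:R * a.2) + toC k * toC (q%:R * b.2).
  by rewrite -rmorphM -rmorphD; congr toC; ring.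
ring.
Qed.

Lemma fin_arho : fin arho = complexify rho. Proof. by []. Qed.
Lemma lev_arho : lev arho = toC (dcox D). Proof. by []. Qed.

Lemma fH_arho a : fH a arho = toC (dot rho a.1 + q%:R * a.2 * dcox D).
Proof. by rewrite /fH fin_arho lev_arho dot_complexify -rmorphM -rmorphD. Qed.

Lemma fH_simple c : lsimple D true c -> 0 < fH c arho.
Proof.
move=> [o _ ->]; rewrite fH_arho ltcR; case: o => [i|] /=.
  by rewrite rho_alpha mulr0 mul0r addr0 ltr01.
rewrite dotNr mulr1 dcoxE; have := rho_theta_ge0 D.
by have : 1 <= q%:R :> R; [rewrite ler1n|nra].
Qed.

Lemma lsimple_affine aff c : lsimple D aff c -> lsimple D true c.
Proof. by move=> [o _ ->]; exists o. Qed.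

Lemma H_realization aff :
  realization (lroot D aff) lpos (@lrefl R r) fH tH arho.
Proof.
apply: (@linear_realization _ _ _ _ _ [the {rmorphism R -> R[i]} of toC]).
- by move=> a b k; apply: clD.
- by move=> a b k x; apply: fHD.
- by move=> a b x t; apply: fH_shift.
- by move=> a b _ _ /(cl_inj q_gt0).
- by move=> c /lsimple_affine; apply: fH_simple.
Qed.

Lemma apair_cl a x : a.1 \in Phi -> apair x (cl q a) = fH a x.
Proof.
move=> Ha; rewrite /apair /fH /cpair -[fin (cl q a)]/(complexify a.1).
rewrite dot_complexify (dot_root Ha) rmorph_nat -[del (cl q a)]/(toC (q%:R * a.2)).
by congr (_ + _); rewrite mulrAC divff ?mul1r // pnatr_eq0.
Qed.

Lemma arefl_cl a : a.1 \in Phi -> arefl (cl q a) = tH a.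
Proof. by move=> Ha; apply/funext => x; rewrite /arefl apair_cl. Qed.

Lemma rroot_cl (j : int) b : rroot j b = cl 1 (b, j%:~R).
Proof. by rewrite /cl mul1r /rroot rmorph_int. Qed.

Lemma cl_scale k a : cl k a = cl 1 (a.1, k%:R * a.2).
Proof. by rewrite /cl mul1r. Qed.

Lemma fH_cone a x : fH a x = \sum_o toC (cf D o a) * fH (sroot D o) x.
Proof.
by apply: (@f_cone _ _ D _ H [the {rmorphism R -> R[i]} of toC] fH) => b c k y; apply: fHD.
Qed.

Lemma cl_cone k a : cl k a = \sum_o toC (cf D o a) *: cl k (sroot D o).
Proof.
rewrite {1}(cfE D a); elim/big_rec2: _ => [|o y b _ <-]; first exact: cl_zero.
by rewrite addrC clD addrC.
Qed.

Lemma fH_inj a b : fH a =1 fH b -> a = b.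
Proof.
move=> E; apply: (cl_inj q_gt0).
have E1 : complexify a.1 = complexify b.1.
  apply: dot_inj => v; have := E (v, 0, 0).
  by rewrite /fH -[lev _]/(0 : R[i]) !mulr0 !addr0.
have E2 : toC (q%:R * a.2) = toC (q%:R * b.2).
  have := E (0, 1, 0); rewrite /fH -[lev _]/(1 : R[i]) -[fin _]/(0 : 'rV_r).
  by rewrite !dot0l !add0r !mulr1.
by rewrite /cl E1 E2.
Qed.

(** * The longest element of the finite Weyl group *)

Section Longest.
Variable w0 : H -> H.
Hypothesis hw0 : is_w0 D w0.

Local Notation Gfin := (generated (tH @` lsimple D false)).
Let rl := labelsP D false.
Let rz := H_realization false.
Let rla := labelsP D true.
Let rza := H_realization true.

Lemma finite_simpleE :
  [set s | exists i : 'I_r, s = arefl (rroot 0 (alpha i))] = tH @` lsimple D false.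
Proof.
have E i : arefl (rroot 0 (alpha i)) = tH (sroot D (Some i)).
  rewrite -(arefl_cl (a := sroot D (Some i)) (alpha_Phi D i)).
  by congr arefl; rewrite rroot_cl [RHS]cl_scale /= mulr0.
apply/seteqP; split=> [_ [i ->]|_ [_ [[i|//] _ ->] <-]]; last by exists i.
by exists (sroot D (Some i)) => //; exists (Some i).
Qed.

Lemma w0_gen : Gfin w0.
Proof. by case: hw0; rewrite finite_simpleE. Qed.

Lemma w0_simple c : lsimple D false c -> fH c (w0 arho) < 0.
Proof. by move: hw0; rewrite /is_w0 finite_simpleE; apply: (longest_neg rl rz). Qed.

(** The negatives of the functions at [w0 arho] are positive on simple roots,
    hence on all positive roots. *)
Lemma w0_neg a : lroot D false a -> lpos a -> fH a (w0 arho) < 0.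
Proof.
move=> Ra Pa; rewrite -oppr_gt0.
apply: (@lin_f_pos _ _ D _ H [the {rmorphism R -> R[i]} of toC] false
  (fun b x => - fH b x) (w0 arho)) => // [b c k x|c Sc].
  by rewrite fHD opprD mulrN.
by rewrite oppr_gt0; apply: w0_simple.
Qed.

Lemma w0_pull a : lroot D false a -> lpos a -> exists b, [/\ lroot D false b,
  lpos (- b), forall x, fH b x = fH a (w0 x) & tH a \o w0 = w0 \o tH b].
Proof.
move=> Ra Pa; have [b [Rb fb tb]] := pull_root rl rz w0_gen Ra.
exists b; split=> //; apply: (neg_of rl rz) => //.
by rewrite fb; apply: w0_neg.
Qed.

Lemma fH_opp a x : fH (- a) x = - fH a x.
Proof. exact: (rz_opp rza). Qed.

Lemma w0K : w0 \o w0 = id.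
Proof.
apply: (id_of_positive rl rz); first exact: generated_comp w0_gen w0_gen.
move=> c Sc; have [Rc Pc] := rl_simple rl Sc.
have [b [Rb Pb fb _]] := w0_pull Rc Pc.
rewrite /= -fb -oppr_lt0 -fH_opp; apply: w0_neg => //; exact: lroot_opp.
Qed.

(** As [w0] exchanges positive and negative roots, it takes [c] to the negative
    of a root whose reflection keeps all other positive roots positive, which
    makes this root simple by [lsimple_of_perm]. *)
Lemma w0_conj_simple c : lsimple D false c ->
  exists2 c', lsimple D false c' & w0 \o tH c \o w0 = tH c'.
Proof.
move=> Sc; have [Rc Pc] := rl_simple rl Sc.
have [b [Rb Pb fb tb]] := w0_pull Rc Pc.
have w0E x : w0 (w0 x) = x by exact: (congr1 (fun h => h x) w0K).
have tE : w0 \o tH c \o w0 = tH (- b).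
  rewrite (rz_trN rz) //; apply/funext => x /=.
  by rewrite -[tH c _]/((tH c \o w0) x) tb /= w0E.
have Rb' := lroot_opp Rb.
exists (- b) => //; apply: lsimple_of_perm => // d Rd Pd db.
apply: (pos_of rl rz); first exact: lroot_refl.
rewrite -(rz_tr rz) // -tE /=.
have [e [Re Pe fe _]] := w0_pull Rd Pd.
rewrite -fe (rz_tr rz) // -oppr_lt0 -fH_opp -lreflN.
have Re' := lroot_opp Re.
apply: w0_neg; first exact: lroot_refl.
apply: (lsimple_perm Sc) => // ec; apply: db; apply: fH_inj => x.
by rewrite fH_opp fb -ec fH_opp fe w0E opprK.
Qed.

(** The sum [d] of [theta] and of its image under [w0] is a nonnegative
    combination of simple roots since [theta] is maximal. It is fixed by [w0],
    so that its value at [arho] is also nonpositive, and [d = 0]. *)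
Lemma w0_theta x : fH (theta, 0) (w0 x) = fH (- theta, 0) x.
Proof.
have Rt : lroot D false ((theta, 0) : L).
  by split; rewrite //= ?eqxx ?rpred0 // theta_Phi.
have Pt : lpos ((theta, 0) : L) by right; split=> //; apply: theta_pos.
have [b [Rb Pb fb _]] := w0_pull Rt Pt.
have w0E y : w0 (w0 y) = y by exact: (congr1 (fun h => h y) w0K).
have b2 : b.2 = 0 by case: Rb => _ _ /= /eqP.
pose d : L := (theta, 0) + b.
have d2 : d.2 = 0 by rewrite /d /= add0r.
have fd y : fH d y = fH (theta, 0) y + fH b y.
  by have := fHD (theta, 0) b 1 y; rewrite scale1r rmorph1 mul1r.
have dinv : fH d (w0 arho) = fH d arho.
  by rewrite !fd !fb w0E addrC.
have cfN : cf D None d = 0 by exact: d2.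
have cfS i : cf D (Some i) d = co D i d.1 by rewrite /cf d2 scale0r addr0.
have cfd o : cf D o d \is a Num.nat.
  case: o => [i|]; last by rewrite cfN rpred0.
  rewrite cfS -[d.1]/(theta + b.1) -[b.1]opprK.
  by apply: theta_above; apply: root_opp; case: Rb.
have ge0 o : 0 <= toC (cf D o d) by rewrite ler0c natr_ge0.
have d0 : fH d arho = 0.
  apply/le_anti/andP; split.
    rewrite -dinv fH_cone; apply: sumr_le0 => o _.
    case: o => [i|]; last by rewrite cfN rmorph0 mul0r.
    apply: mulr_ge0_le0 => //; apply: ltW; apply: w0_simple.
    by exists (Some i).
  rewrite fH_cone; apply: sumr_ge0 => o _; apply: mulr_ge0 => //.
  by apply: ltW; apply: fH_simple; exists o.
have d10 : d.1 = 0.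
  apply: (@co_inj _ _ D) => i; rewrite co0.
  have /complexI/eqP : toC (dot rho d.1) = toC 0.
    by rewrite rmorph0 -[RHS]d0 fH_arho d2 mulr0 mul0r addr0.
  rewrite (rho_root D) psumr_eq0; first by move=> /allP /(_ i (mem_index_enum _)) /= /eqP.
  by move=> j _; have := natr_ge0 (cfd (Some j)); rewrite cfS.
rewrite -fb; congr (fH _ x); rewrite [LHS]surjective_pairing b2; congr (_, _).
by apply/eqP; rewrite -addr_eq0 addrC -[_ + _]/(d.1) d10.
Qed.

Lemma lev_gen w x : generated (tH @` lsimple D true) w -> lev (w x) = lev x.
Proof.
move=> [n]; elim=> [//|m _ v [c _ <-] _ IH].
by rewrite /= tHE levB -[lev (cl q c)]/(0 : R[i]) mulr0 subr0.
Qed.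

(** The action of [w0] on [delta] is trivial. *)
Lemma w0_affine : w0 \o tH (theta, 1) \o w0 = tH (sroot D None).
Proof.
have Rt : lroot D true ((theta, 1) : L) by split; rewrite //= ?rpred1 // theta_Phi.
have G0 : generated (tH @` lsimple D true) w0.
  apply: (generated_sub _ w0_gen) => _ [c Sc <-]; apply: generated_gen.
  by exists c => //; apply: lsimple_affine Sc.
have [b [Rb fb tb]] := pull_root rla rza G0 Rt.
have w0E y : w0 (w0 y) = y by exact: (congr1 (fun h => h y) w0K).
have -> : sroot D None = b.
  apply: fH_inj => x; rewrite fb.
  have split1 v y : fH (v, 1) y = fH (v, 0) y + toC q%:R * lev y.
    by rewrite /fH /= mulr0 mulr1 rmorph0 mul0r addr0.
  by rewrite split1 w0_theta lev_gen //; apply: split1.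
by apply/funext => x /=; rewrite -[tH _ _]/((tH (theta, 1) \o w0) x) tb /= w0E.
Qed.

End Longest.

End AffineSide.

(** * Integral Weyl groups and antidominant weights *)

Section IsInt.
Variable F : pzRingType.
Implicit Types x y : F.

Lemma is_intD x y : is_int x -> is_int y -> is_int (x + y).
Proof. by move=> [m ->] [n ->]; exists (m + n); rewrite rmorphD. Qed.

Lemma is_intN x : is_int x -> is_int (- x).
Proof. by move=> [m ->]; exists (- m); rewrite rmorphN. Qed.

Lemma is_intM x y : is_int x -> is_int y -> is_int (x * y).
Proof. by move=> [m ->] [n ->]; exists (m * n); rewrite rmorphM. Qed.

Lemma is_intDl x y : is_int x -> is_int (x + y) -> is_int y.
Proof. by move=> Hx Hxy; rewrite -[y](addKr x); apply: is_intD => //; apply: is_intN. Qed.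

End IsInt.

Section IntegralWeights.
Variables (R : realType) (r : nat) (D : root_datum R r).
Local Notation V := 'rV[R]_r.
Local Notation Phi := (Phi D).
Local Notation alpha := (alpha D).
Local Notation theta := (theta D).
Local Notation pos_root := (pos_root D).
Local Notation rho := (frho D).
Local Notation arho := (arho D).
Local Notation L := (V * R^o)%type.
Local Notation H := (hdual R r).
Local Notation toC := (real_complex R).
Local Notation lpos := (lpos D).

Lemma is_int_toC (x : R) : is_int (toC x) <-> x \is a Num.int.
Proof.
split=> [[m]|/intrP [m ->]]; last by exists m; rewrite rmorph_int.
by rewrite -(rmorph_int toC) => /complexI ->; apply: intr_int.
Qed.

Definition fin_integral (x : H) :=
  forall b, b \in Phi -> is_int (dot (fin x) (complexify b)).

Lemma fin_integral_weight lambda :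
  (forall i, is_int (apair lambda (rroot 0 (alpha i)))) ->
  fin_integral (lambda + arho).
Proof.
move=> Hi b Hb; rewrite finD dotDl; apply: is_intD; last first.
  rewrite fin_arho dot_complexify; apply/is_int_toC; exact: int_rho.
have -> : complexify b = \sum_i toC (co D i b) *: complexify (alpha i).
  rewrite {1}(coE D b); elim/big_rec2: _ => [|i y x _ <-].
    by apply/rowP => i; rewrite !mxE.
  by rewrite addrC complexifyD addrC.
rewrite dotC dot_suml; elim/big_rec: _ => [|i x _ Ix]; first by exists 0.
apply: is_intD Ix; rewrite dotZl dotC; apply: is_intM.
  apply/is_int_toC; case: (root_sign Hb) => /pos_rootP [_ Hn]; first exact: intr_nat.
  by rewrite -rpredN -coN; apply: intr_nat.
have := Hi i.
rewrite rroot_cl (apair_cl 1 lambda (a := (alpha i, 0%:~R)) (alpha_Phi D i)).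
by rewrite /fH /= mulr0 rmorph0 mul0r addr0.
Qed.

(** If [lambda + rho] has level [k] and integral finite part, [Phi(lambda)]
    consists of the real roots [b + j delta] with [j] divisible by [q]. *)
Definition level_period (k : R[i]) (q : nat) :=
  forall j : int, is_int (j%:~R * k) <-> exists m : int, j = q%:Z * m.

(** The period is the denominator of the level. *)
Lemma rat_level_period (k : R[i]) : is_rat k -> k != 0 ->
  exists2 q, (0 < q)%N & level_period k q.
Proof.
move=> [p ->] k0; have p0 : p != 0 by apply: contraNneq k0 => ->; rewrite rmorph0.
exists `|denq p|%N; first by rewrite absz_gt0 denq_neq0.
have dE : `|denq p|%:Z = denq p by rewrite gez0_abs // denq_ge0.
have pE : p = (numq p)%:~R / (denq p)%:~R by rewrite divq_num_den.
have d0 : (denq p)%:~R != 0 :> rat by rewrite intr_eq0 denq_neq0.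
move=> j; rewrite dE; split=> [[m]|[m ->]]; last first.
  exists (m * numq p).
  have -> : (denq p * m)%:~R * ratr p = ratr ((denq p * m)%:~R * p) :> R[i].
    by rewrite (rmorphM (@ratr R[i])) /= ratr_int.
  rewrite -[RHS]ratr_int; congr ratr.
  by rewrite [X in _ * X]pE !rmorphM /=; field.
have -> : j%:~R * ratr p = ratr (j%:~R * p) :> R[i] by rewrite (rmorphM (@ratr R[i])) /= ratr_int.
rewrite -(ratr_int _ m) => /fmorph_inj.
rewrite {1}pE mulrA => /(congr1 (fun z => z * (denq p)%:~R)); rewrite divfK //.
move=> E; have {}E : j * numq p = m * denq p.
  by apply: (@intr_inj rat); rewrite !rmorphM /= E.
have : (denq p %| j * numq p)%Z by rewrite E dvdz_mull.
rewrite Gauss_dvdzl; last by rewrite coprimezE coprime_sym coprime_num_den.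
by move=> /dvdzP [t ->]; exists t; rewrite mulrC.
Qed.

Lemma half_level_period l : (0 < l)%N ->
  level_period (- (l%:R / 2)) (if odd l then 2 else 1).
Proof.
move=> l0 j; have two0 : (2 : R[i]) != 0 by rewrite pnatr_eq0.
split.
  case: ifP => odl; last by exists j; rewrite mul1r.
  move=> [m E]; have {}E : j * l%:Z = (- m) * 2.
    apply: (@intr_inj R[i]); have -> : (- m * 2)%:~R = - m%:~R * 2 :> R[i].
      by rewrite rmorphM /= rmorphN.
    by rewrite rmorphM /= -E -pmulrn; field.
  have : (2 %| j * l%:Z)%Z by rewrite E dvdz_mull.
  rewrite Gauss_dvdzl; last by rewrite coprimezE /= coprime2n.
  by move=> /dvdzP [t ->]; exists t; rewrite mulrC.
move=> [m ->]; case: ifP => odl.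
  by exists (- m * l%:Z); rewrite !rmorphM /= rmorphN /= -!pmulrn; field.
have lE : l%:R = l./2%:R * 2 :> R[i].
  by rewrite -natrM muln2 -{1}(odd_double_half l) odl.
exists (- m * l./2%:Z); rewrite lE mul1r.
by rewrite !rmorphM /= rmorphN /= -!pmulrn; field.
Qed.

Lemma even_lattice x : root_lattice D x -> exists k : int, dot x x = 2 * k%:~R.
Proof.
move=> [n ->]; pose P y := root_lattice D y /\ exists k : int, dot y y = 2 * k%:~R.
suff [] : P (\sum_i alpha i *~ n i) by [].
elim/big_rec: _ => [|i y _ [Qy [k yy]]].
  by split; [exact: root_lattice0|exists 0; rewrite dot0l mulr0].
rewrite -scaler_int; have Ha := alpha_Phi D i.
split.
  by apply: root_latticeD Qy; apply: root_latticeZ; [apply: intr_int|apply: root_lattice_root].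
have /intrP [t yt] := int_dot_lattice Qy Ha.
exists (n i * n i + n i * t + k).
rewrite dotDl !dotDr !dotZl !dotZr (dotC _ y) yt yy (dot_root Ha) !rmorphD !rmorphM /=.
ring.
Qed.

(** The number [2 s], which is the pairing with [c], is an integer, and its
    square is divisible by 4 as the root lattice is even. *)
Lemma int_multiple s c : c \in Phi -> root_lattice D (s *: c) -> s \is a Num.int.
Proof.
move=> Hc Qc; have := int_dot_lattice Qc Hc.
rewrite dotZl (dot_root Hc) => /intrP [t st].
have [k] := even_lattice Qc; rewrite dotZl dotZr (dot_root Hc) => sk.
have E : t * t = 4 * k.
  apply: (@intr_inj R); rewrite !rmorphM /= -st.
  transitivity (2 * (s * (s * 2))); [by ring|rewrite sk].
  by have -> : 4%:~R = 4 :> R by []; ring.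
have [u tu] : exists u, t = 2 * u.
  exists (t %/ 2)%Z; have : t = 2 * (t %/ 2)%Z \/ t = 2 * (t %/ 2)%Z + 1 by lia.
  by case=> // tE; exfalso; move: E; rewrite tE; set v := (_ %/ _)%Z; nia.
apply/intrP; exists u; apply: (mulIf (x := 2)); first by rewrite pnatr_eq0.
by rewrite st tu rmorphM /= mulrC.
Qed.

(** The multiplier is real as a quotient of coordinates; it is then an integer
    by [int_multiple], and nonnegative by comparing heights. *)
Lemma le_h_multiple (a : L) (m : R[i]) (n0 : nat) (n : 'I_r -> nat) :
  lroot D true a -> lpos a ->
  m *: cl 1 a = rroot 1 (- theta) *+ n0 + \sum_i rroot 0 (alpha i) *+ n i ->
  is_int m /\ 0 <= m.
Proof.
move=> Ra Pa E; have [Ha _ _] := Ra.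
pose z : L := sroot D None *+ n0 + \sum_i sroot D (Some i) *+ n i.
have {}E : m *: cl 1 a = cl 1 z.
  rewrite E /z cl_add cl_natmul rroot_cl; congr (_ *+ _ + _).
  rewrite (big_morph (cl 1) (cl_add 1) (cl_zero R r 1)); apply: eq_bigr => i _.
  by rewrite cl_natmul rroot_cl.
have cfz o : cf D o z \is a Num.nat.
  rewrite /z cfD; apply: rpredD.
    by rewrite -scaler_nat cfZ cf_sroot; apply: rpredM; apply: natr_nat.
  elim/big_rec: _ => [|i y _ Iy].
    by rewrite -(scale0r 0) cfZ mul0r rpred0.
  rewrite cfD; apply: rpredD => //.
  by rewrite -scaler_nat cfZ cf_sroot; apply: rpredM; apply: natr_nat.
have Qz : root_lattice D z.1.
  rewrite /z; apply: root_latticeD.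
    rewrite -scaler_nat; apply: root_latticeZ; first exact: natr_int.
    by apply: root_lattice_root; apply: root_opp; apply: theta_Phi.
  elim/big_rec: _ => [|i y _ Qy]; first exact: root_lattice0.
  apply: root_latticeD => //; rewrite -scaler_nat; apply: root_latticeZ; first exact: natr_int.
  by apply: root_lattice_root; apply: alpha_Phi.
have [j aj] : exists j, a.1 0 j != 0.
  apply: contrapT => no; apply: (root_neq0 Ha); apply/rowP => j; rewrite mxE.
  by apply: contrapT => /eqP aj; apply: no; exists j.
have [s ms] : exists s : R, m = toC s.
  exists (z.1 0 j / a.1 0 j); have := congr1 (fun x : H => (fin x) 0 j) E.
  rewrite -[(fin (m *: _)) 0 j]/((m *: complexify a.1) 0 j) !mxE => Ej.
  apply: (mulIf (x := toC (a.1 0 j))); first by rewrite fmorph_eq0.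
  by rewrite Ej -rmorphM divfK //; apply: mxE.
move: E; rewrite ms -cl_scaled => /(cl_inj (ltn0Sn 0)) sz.
split; first by apply/is_int_toC; apply: (int_multiple Ha); rewrite -sz in Qz.
rewrite ler0c leNgt; apply/negP => s0.
have := height_gt0 Ra Pa; rewrite /height ltNge => /negP; apply.
apply: sumr_le0 => o _; have := natr_ge0 (cfz o); rewrite -sz cfZ.
by rewrite nmulr_rge0.
Qed.

Lemma le_h_of_multiple (a : L) (m : nat) : lroot D true a -> lpos a ->
  exists (n0 : nat) (n : 'I_r -> nat),
    m%:R *: cl 1 a = rroot 1 (- theta) *+ n0 + \sum_i rroot 0 (alpha i) *+ n i.
Proof.
move=> Ra Pa.
exists (m * Num.truncn (cf D None a))%N, (fun i => m * Num.truncn (cf D (Some i) a))%N.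
have E o (x : H) : m%:R *: (toC (cf D o a) *: x) = x *+ (m * Num.truncn (cf D o a)).
  rewrite -{1}(truncnK (cf_nat Ra Pa o)) rmorph_nat scalerA -natrM.
  by rewrite scaler_nat.
rewrite (cl_cone D 1 a) scaler_sumr big_option E rroot_cl; congr (_ + _).
by apply: eq_bigr => i _; rewrite E rroot_cl.
Qed.

Section Lambda.
Variables (lambda : H) (q : nat).
Hypotheses (q_gt0 : (0 < q)%N) (lam_int : fin_integral (lambda + arho)).
Hypothesis lam_period : level_period (lev (lambda + arho)) q.

Lemma Phi_of_mem (x : H) (j : int) b : b \in Phi -> fin_integral x ->
  lev x = lev (lambda + arho) -> is_int (apair x (rroot j b)) ->
  exists a, [/\ lroot D true a, rroot j b = cl q a & j%:~R = q%:R * a.2 :> R].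
Proof.
move=> Hb Ix Lx; rewrite rroot_cl (apair_cl 1 x (a := (b, j%:~R)) Hb) /fH /= mul1r.
rewrite rmorph_int => /(is_intDl (Ix _ Hb)); rewrite Lx => /lam_period [m jm].
have jE : j%:~R = q%:R * m%:~R :> R by rewrite jm rmorphM /= pmulrn.
exists (b, m%:~R); split=> //.
  by split; rewrite //=; apply: intr_int.
by rewrite [RHS]cl_scale jE.
Qed.

Lemma Phi_ofE : Phi_of D lambda = cl q @` lroot D true.
Proof.
apply/seteqP; split=> [_ [[j [b [Hb ->]]]]|_ [a [Ha Ja _] <-]].
  by move=> /(Phi_of_mem Hb lam_int erefl) [a [Ra -> _]]; exists a.
have /intrP [m am] := Ja; split.
  exists (q%:Z * m), a.1; split=> //; rewrite rroot_cl cl_scale; congr (cl 1 (_, _)).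
  by rewrite rmorphM /= am pmulrn.
rewrite (apair_cl q _ Ha) /fH; apply: is_intD; first exact: lam_int.
have -> : toC (q%:R * a.2) = (q%:Z * m)%:~R.
  by rewrite am -(rmorph_int toC); congr toC; rewrite rmorphM /= pmulrn.
by apply/lam_period; exists m.
Qed.

Lemma pos_real_root_cl a : lroot D true a -> (pos_real_root D (cl q a) <-> lpos a).
Proof.
move=> [Ha /intrP [m am] _]; have q0 : 0 < q%:R :> R by rewrite ltr0n.
split=> [[j [b [Hb]]]|Pa].
  rewrite rroot_cl cl_scale => /(cl_inj (ltn0Sn 0)) [E jE].
  case=> [j0|[j0 Pb]]; [left|right; split; last by rewrite E].
    by rewrite -(pmulr_rgt0 _ q0) jE ltr0z.
  by apply: (mulfI (lt0r_neq0 q0)); rewrite jE j0 mulr0.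
exists (q%:Z * m), a.1; split=> //.
  rewrite rroot_cl cl_scale; congr (cl 1 (_, _)).
  by rewrite rmorphM /= am pmulrn.
case: Pa => [|[a0 Pa]]; first by rewrite am ltr0z => m0; left; rewrite mulr_gt0.
right; split=> //; move: a0; rewrite am => /eqP.
by rewrite intr_eq0 => /eqP ->; rewrite mulr0.
Qed.

Lemma Phi_of_posE : Phi_of_pos D lambda = cl q @` (lroot D true `&` lpos).
Proof.
rewrite /Phi_of_pos Phi_ofE; apply/seteqP; split=> [_ [[a Ra <-]]|_ [a [Ra Pa] <-]].
  by move=> /(pos_real_root_cl Ra) Pa; exists a.
by split; [exists a|apply/pos_real_root_cl].
Qed.

Let rl := labelsP D true.
Let rz := H_realization D q_gt0 true.

Lemma W_ofE : W_of D lambda = generated (tH q @` lsimple D true).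
Proof.
rewrite /W_of Phi_ofE -(generated_roots rl rz); congr generated.
apply/seteqP; split=> [_ [_ [a Ra <-] <-]|_ [a Ra <-]].
  by exists a => //; rewrite (arefl_cl q (lroot_phi Ra)).
by exists (cl q a); [exists a|rewrite (arefl_cl q (lroot_phi Ra))].
Qed.

Lemma tH_cl (a b : L) : tH q a (cl q b) = cl q (lrefl a b).
Proof.
rewrite tHE /lrefl -[in RHS]scaleNr clD rmorphN scaleNr.
by rewrite /fH -[lev _]/(0 : R[i]) mulr0 addr0 dot_complexify.
Qed.

Lemma W_of_simpleE : W_of_simple D lambda = tH q @` lsimple D true.
Proof.
rewrite /W_of_simple Phi_of_posE; apply/seteqP; split=> [s|_ [c Sc <-]].
  move=> [_ [[a [Ra Pa] <-] ->]]; rewrite (arefl_cl q (lroot_phi Ra)) => E.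
  exists a => //; apply: lsimple_of_perm => // b Rb Pb ba.
  have : (tH q a @` (cl q @` (lroot D true `&` lpos) `\ cl q a)) (tH q a (cl q b)).
    exists (cl q b) => //; split; first by exists b.
    by move=> /(cl_inj q_gt0).
  rewrite E tH_cl => -[[d [Rd Pd] /(cl_inj q_gt0) <-] _]; exact: Pd.
have [Rc Pc] := rl_simple rl Sc.
exists (cl q c); rewrite (arefl_cl q (lroot_phi Rc)); split=> //; first by exists c.
have stable b : (cl q @` (lroot D true `&` lpos) `\ cl q c) b ->
    (cl q @` (lroot D true `&` lpos) `\ cl q c) (tH q c b).
  move=> [[a [Ra Pa] <-] ac]; rewrite tH_cl.
  have {}ac : a <> c by move=> E; apply: ac; rewrite E.
  have Pl := lsimple_perm Sc Ra Pa ac; have Rl := lroot_refl Ra Rc.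
  split; first by exists (lrefl c a).
  move=> /(cl_inj q_gt0) E.
  have : lrefl c (lrefl c a) = lrefl c c by rewrite E.
  rewrite (lrefl_self Rc) => E'; apply: (lpos_excl Rc Pc).
  have <- : a = - c; last exact: Pa.
  rewrite -E'; apply: (cl_inj q_gt0); rewrite -!tH_cl.
  by rewrite -[RHS]/((tH q c \o tH q c) (cl q a)) (rz_trK rz Rc).
apply/seteqP; split=> [_ [b Sb <-]|b Sb]; first exact: stable.
exists (tH q c b); first exact: stable.
by rewrite -[LHS]/((tH q c \o tH q c) b) (rz_trK rz Rc).
Qed.

Local Notation fH := (fH q).
Local Notation tH := (tH q).
Local Notation G := (generated (tH @` lsimple D true)).
Local Notation rstep := (rstep (lroot D true) fH tH arho).
Local Notation p := (lambda + arho).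

Hypothesis lam_anti : forall a, Phi_of_pos D lambda a -> apair p a <= 0.

Lemma fH_anti a : lroot D true a -> lpos a -> fH a p <= 0.
Proof.
move=> Ra Pa; rewrite -(apair_cl q _ (lroot_phi Ra)); apply: lam_anti.
by rewrite Phi_of_posE; exists a.
Qed.

Lemma fH_fixed a : lroot D true a -> fH a p = 0 -> tH a p = p.
Proof. by move=> _ fa; rewrite tHE fa scale0r subr0. Qed.

Lemma fin_integral_gen w : G w -> fin_integral (w p).
Proof.
move=> [n]; elim=> [//|m _ v [c Sc <-] Hv IH] b Hb.
have Gv : G v by exists m.
have [Rc _] := rl_simple rl Sc; have [Hc /intrP [t ct] _] := Rc.
rewrite /= tHE finB dotDl dotNl dotZl; apply: is_intD; first exact: IH.
apply/is_intN/is_intM; last first.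
  by rewrite -[fin _]/(complexify c.1) dot_complexify; apply/is_int_toC/(int_dot_root Hc Hb).
rewrite /fH; apply: is_intD; first exact: IH.
rewrite (lev_gen p Gv).
have -> : toC (q%:R * c.2) = (q%:Z * t)%:~R.
  by rewrite ct -(rmorph_int toC); congr toC; rewrite rmorphM /= pmulrn.
by apply/lam_period; exists t.
Qed.

Lemma fH_int w a : G w -> lroot D true a -> is_int (fH a (w p)).
Proof.
move=> Gw [Ha /intrP [t ct] _]; rewrite /fH; apply: is_intD.
  exact: fin_integral_gen.
rewrite (lev_gen p Gw).
have -> : toC (q%:R * a.2) = (q%:Z * t)%:~R.
  by rewrite ct -(rmorph_int toC); congr toC; rewrite rmorphM /= pmulrn.
by apply/lam_period; exists t.
Qed.

Lemma scaled_label a : lroot D true a -> lpos a ->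
  lroot D true ((a.1, q%:R * a.2) : L) /\ lpos ((a.1, q%:R * a.2) : L).
Proof.
move=> [Ha Ja _] Pa; split; first by split=> //=; apply: rpredM => //; apply: natr_int.
case: Pa => [a0|[a0 Pa]]; [left|right; split=> //=].
  by rewrite /= mulr_gt0 // ltr0n.
by rewrite a0 mulr0.
Qed.

Lemma up_h_of_chain y w : G y -> chain (rstep lpos) y w ->
  up_h D (adot D y lambda) (adot D w lambda).
Proof.
move=> Gy; elim=> [|x z yx IH [a [Ra Pa fa ->]]]; first exact: up_h_refl.
have Gx := chain_gen rl rz yx Gy; have Ha := lroot_phi Ra.
have aE : adot D (arefl (cl q a)) (adot D (tH a \o x) lambda) = adot D x lambda.
  rewrite /adot subrK (arefl_cl q Ha) /=.
  by rewrite -[tH a (tH a _)]/((tH a \o tH a) (x p)) (rz_trK rz Ra).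
apply: (up_h_step (b := cl q a)); first exact/(pos_real_root_cl Ra).
  rewrite aE /le_h /adot opprB addrA subrK /= tHE addrC addKr.
  have [b [Rb fb _]] := pull_root rl rz Gx Ra.
  have Pb : lpos b by apply: (pos_of rl rz) => //; rewrite fb.
  have le0 : fH a (x p) <= 0 by rewrite -fb; apply: fH_anti.
  have [t tE] := fH_int Gx Ra.
  have [m mE] : exists m : nat, - fH a (x p) = m%:R.
    rewrite tE lerz0 in le0; exists `|t|%N; rewrite tE.
    have {1}-> : t = - (`|t|%N : int) by lia.
    by rewrite rmorphN opprK.
  have [Ra' Pa'] := scaled_label Ra Pa.
  rewrite -scaleNr mE cl_scale.
  exact: le_h_of_multiple.
by rewrite aE.
Qed.

(** A step with multiplier [0] is trivial. Otherwise the multiplier is a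
    positive integer, the root belongs to [Phi(lambda)], and, [lambda] being
    antidominant, its preimage under [w] is a negative root. *)
Lemma chain_of_up_h mu nu : up_h D mu nu -> forall w, G w -> nu = adot D w lambda ->
  exists y, [/\ G y, mu = adot D y lambda & chain (rstep lpos) y w].
Proof.
elim=> [|x b Pb dom _ IH] w Gw xE; first by exists w; split=> //; apply: chain_refl.
have xp : x + arho = w p by rewrite xE /adot subrK.
case: (Pb) => j [c [Hc bE Pjc]].
have Rl : lroot D true ((c, j%:~R) : L) by split; rewrite //= intr_int.
have Pl : lpos ((c, j%:~R) : L).
  by case: Pjc => [j0|[-> Pc]]; [left; rewrite /= ltr0z|right].
have stE : adot D (arefl b) x = x - apair (w p) b *: b.
  by rewrite /adot xp /arefl -xp addrAC addrK.
have [n0 [n nE]] := dom; rewrite stE opprB addrC subrK in nE.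
rewrite {2}bE rroot_cl in nE.
have [Im m0] := le_h_multiple Rl Pl nE.
have [m00|m00] := eqVneq (apair (w p) b) 0.
  by apply: IH => //; rewrite stE m00 scale0r subr0.
have [a [Ra ba _]] : exists a, [/\ lroot D true a, rroot j c = cl q a & j%:~R = q%:R * a.2 :> R].
  apply: (Phi_of_mem Hc (fin_integral_gen Gw) (lev_gen p Gw)).
  by rewrite -bE.
have Ha := lroot_phi Ra.
have Pa : lpos a by apply/(pos_real_root_cl Ra); rewrite -ba -bE.
rewrite bE ba (apair_cl q _ Ha) in m0 m00.
have fpos : 0 < fH a (w p) by rewrite lt_neqAle eq_sym m00.
have Gaw : G (tH a \o w) by apply: generated_comp => //; apply: (tr_gen rl rz).
have [|y [Gy muE yw]] := IH _ Gaw.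
  by rewrite bE ba (arefl_cl q Ha) /adot xp.
exists y; split=> //; apply: chain_step yw _.
have [d [Rd fd _]] := pull_root rl rz Gw Ra.
have fneg : fH a (w arho) < 0.
  case: (sign_orbit rl rz Gw Ra) => // fp.
  have Pd : lpos d by apply: (pos_of rl rz) => //; rewrite fd.
  have := fH_anti Rd Pd; rewrite fd => /(lt_le_trans fpos).
  by rewrite ltxx.
exists a; split=> //; first by rewrite /= (f_self rl rz) // oppr_gt0.
by rewrite (trK_app rz).
Qed.

(** The chain below [w] obtained from [up_h] starts at some [z] of the coset
    of [y], and [y] is below all of its coset. *)
Lemma antidominant_order y w : W_of D lambda y -> W_of D lambda w ->
  minimal_in (le_W D lambda) (senders D lambda (adot D y lambda)) y ->
  (le_W D lambda y w <-> up_h D (adot D y lambda) (adot D w lambda)).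
Proof.
rewrite /le_W W_of_simpleE W_ofE => Gy Gw [_ miny].
split=> [/(bruhatE rl rz) [_ yw]|]; first exact: up_h_of_chain.
move=> /chain_of_up_h /(_ w Gw erefl) [z [Gz zy zw]].
apply/(bruhatE rl rz); split=> //; apply: chain_trans zw.
have [v [Gv vy yv]] := gen_inv rl rz Gy.
have zp : z p = y p by move/addIr: zy.
have zE : z = y \o (v \o z) by rewrite compA yv.
rewrite zE; apply: (minimal_below_coset rl rz fH_anti fH_fixed) => //.
- exact: generated_comp.
- by rewrite /= zp -[v _]/((v \o y) p) vy.
- by move=> u Gu up; apply: miny; split; [rewrite W_ofE|rewrite /adot up].
Qed.

End Lambda.
End IntegralWeights.

(** * Comparison of the two Bruhat orders *)

Section Comparison.
Variables (R : realType) (r : nat) (D : root_datum R r).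
Variable w0 : hdual R r -> hdual R r.
Hypothesis hw0 : is_w0 D w0.
Local Notation V := 'rV[R]_r.
Local Notation alpha := (alpha D).
Local Notation theta := (theta D).
Local Notation arho := (arho D).
Local Notation L := (V * R^o)%type.
Local Notation H := (hdual R r).
Local Notation toC := (real_complex R).
Local Notation conj := (conj_by w0).

Lemma w0_invol : w0 \o w0 = id.
Proof. exact: (w0K (ltn0Sn 0) hw0). Qed.

Lemma w0_app x : w0 (w0 x) = x.
Proof. exact: (congr1 (fun h => h x) w0_invol). Qed.

Lemma conjK y : conj (conj y) = y.
Proof. by apply/funext => x; rewrite /conj_by /= !w0_app. Qed.

Lemma conj_comp y z : conj (y \o z) = conj y \o conj z.
Proof. by apply/funext => x; rewrite /conj_by /= w0_app. Qed.

Lemma le_W'_conj lambda y w :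
  le_W' D w0 lambda (conj y) (conj w) <-> le_W D lambda y w.
Proof. by rewrite /le_W' !conjK. Qed.

Lemma minimal_conj lambda (A : set (H -> H)) y :
  minimal_in (le_W' D w0 lambda) (conj @` A) (conj y) <->
  minimal_in (le_W D lambda) A y.
Proof.
split=> [[[z Az zy] miny]|[Ay miny]].
  have Ay : A y by rewrite -(conjK y) -zy conjK.
  split=> // u Au uy; rewrite -(conjK u) -(conjK y); congr conj.
  by apply: miny; [exists u|apply/le_W'_conj].
split; first by exists y.
by move=> _ [u Au <-] /le_W'_conj uy; congr conj; apply: miny.
Qed.

Lemma fin_integral_Cminus lambda : Cminus_rat D lambda -> fin_integral D (lambda + arho).
Proof. by move=> [_ Hi _]; apply: fin_integral_weight. Qed.

Lemma Cminus_rat_period lambda : Cminus_rat D lambda ->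
  exists2 q, (0 < q)%N & level_period (lev (lambda + arho)) q.
Proof.
move=> [[k0 _] _ [x xE]]; apply: rat_level_period => //.
have /intrP [m mE] := int_rho (theta_Phi D).
exists (x + (1 + m%:~R)); rewrite levD lev_arho dcoxE mE xE.
by rewrite !rmorphD !rmorph1 /= !rmorph_int.
Qed.

Section Phi.
Variables (l : nat) (lambda : H).
Hypotheses (l_gt0 : (0 < l)%N) (lam_rat : Cminus_rat D lambda).
Hypothesis lam_level : - (lev lambda + toC (dcox D)) = l%:R / 2.
Variable phi : (V -> V) -> (H -> H).
Hypothesis phiP : is_phi D l lambda phi.

Local Notation e := (e_of l).
Local Notation q := (if odd l then 2 else 1)%N.
Local Notation tV := (tV D e).
Local Notation tH := (tH q).

Lemma e_gt0 : (0 < e)%N.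
Proof. by rewrite /e_of; case: ifP => // odl; lia. Qed.

Lemma q_gt0 : (0 < q)%N. Proof. by case: ifP. Qed.

Let rl := labelsP D true.
Let rzV := base_realization D e_gt0.
Let rzH := H_realization D q_gt0 true.
Local Notation G := (generated (tV @` lsimple D true)).

Lemma phi_period : level_period (lev (lambda + arho)) q.
Proof.
rewrite levD lev_arho -[_ + _]opprK lam_level; exact: half_level_period.
Qed.

Lemma phi_comp u v : G u -> G v -> phi (u \o v) = phi u \o phi v.
Proof. by case: phiP => _ H _ _ Gu Gv; apply: H; rewrite WeE //; exact: e_gt0. Qed.

Lemma phi_inj u v : G u -> G v -> phi u = phi v -> u = v.
Proof.
rewrite -(WeE D e_gt0) => Gu Gv; case: phiP => [[_ inj _] _ _ _].
by apply: inj; apply: mem_set.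
Qed.

Lemma tV_gen a : lroot D true a -> G (tV a).
Proof. exact: (tr_gen rl rzV). Qed.

Lemma phi_simple c : lsimple D false c -> phi (tV c) = tH c.
Proof.
case: phiP => _ _ H _ [[i|//] _ ->]; have Ha := alpha_Phi D i.
rewrite -(hrefl_tV e (a := sroot D (Some i)) Ha) /= mul0r oppr0 H.
rewrite -(arefl_cl q (a := sroot D (Some i)) Ha); congr arefl.
by rewrite rroot_cl [RHS]cl_scale /= mulr0.
Qed.

Lemma phi_id : phi id = id.
Proof.
have Sc : lsimple D false (sroot D (Some (Ordinal (rank_gt0 D)))).
  by exists (Some (Ordinal (rank_gt0 D))).
have [Rc _] := rl_simple rl (lsimple_affine Sc).
rewrite -(rz_trK rzV Rc) phi_comp ?phi_simple ?(rz_trK rzH Rc) //; exact: tV_gen.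
Qed.

Lemma phi_finite a : lroot D false a -> lpos D a -> phi (tV a) = tH a.
Proof.
move: a; apply: label_ind; first exact: phi_simple.
move=> a c Sc Ra Pa Pca IH.
have [Rc _] := rl_simple rl (lsimple_affine Sc).
have Ra' := lroot_affine Ra; have Rca := lroot_refl Ra' Rc.
have E (F : numDomainType) (X : Type) (f : L -> X -> F) tr x0 :
    realization (lroot D true) (lpos D) (@lrefl R r) f tr x0 ->
    tr a = tr c \o (tr (lrefl c a) \o tr c).
  move=> rz; rewrite (rz_conj rz) //; apply/funext => x /=.
  have cc y : tr c (tr c y) = y.
    exact: (congr1 (fun h => h y) (rz_trK rz Rc)).
  by rewrite !cc.
have Gc := tV_gen Rc; have Gca := tV_gen Rca.
rewrite (E _ _ _ _ _ rzV) (E _ _ _ _ _ rzH).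
by rewrite phi_comp ?phi_comp ?IH ?phi_simple //; apply: generated_comp.
Qed.

(** The reflection in the upper wall of the alcove is conjugate, by the
    reflection in [theta], to the one on which [phi] is prescribed. *)
Lemma phi_affine : phi (tV (sroot D None)) = tH (theta, 1).
Proof.
have Ht := theta_Phi D.
have R0 : lroot D false ((theta, 0) : L) by split; rewrite //= ?eqxx ?rpred0.
have P0 : lpos D ((theta, 0) : L) by right; split=> //; apply: theta_pos.
have R0' := lroot_affine R0.
have R1 : lroot D true ((theta, 1) : L) by split; rewrite //= rpred1.
have RN : lroot D true (sroot D None) by apply: sroot_root.
have t2 : theta - (2 : R) *: theta = - theta.
  by rewrite scaler_nat mulr2n opprD addNKr.
have E1 : sroot D None = lrefl (theta, 0) (theta, 1).
  have E2 : 1 - dot theta theta * 0 = 1 :> R by rewrite mulr0 subr0.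
  rewrite /lrefl [RHS]surjective_pairing.
  rewrite -[X in (X, _)]/(theta - dot theta theta *: theta).
  by rewrite -[X in (_, X)]/(1 - dot theta theta * 0) E2 (dot_root Ht) t2.
have E2 : ((theta, 1) : L) = lrefl (theta, 0) (sroot D None).
  rewrite /lrefl [RHS]surjective_pairing; congr (_, _).
    rewrite -[RHS]/(- theta - dot (- theta) theta *: theta).
    by rewrite dotNl (dot_root Ht) scaleNr opprK scaler_nat mulr2n addKr.
  by rewrite -[RHS]/(1 - dot (- theta) theta * 0) mulr0 subr0.
have phi1 : phi (tV (theta, 1)) = tH (sroot D None).
  rewrite -(hrefl_tV e (a := (theta, 1)) Ht) /= mul1r.
  case: phiP => _ _ _ ->; rewrite -(arefl_cl q (a := sroot D None) (root_opp Ht)).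
  congr arefl; rewrite cl_scale /= mulr1 rroot_cl.
  by congr (cl 1 (_, _)); case: ifP.
have G0 := tV_gen R0'; have G1 := tV_gen R1.
rewrite E1 (rz_conj rzV R1 R0') [in RHS]E2 (rz_conj rzH RN R0').
by rewrite (phi_comp (generated_comp G0 G1) G0) (phi_comp G0 G1) phi1 (phi_finite R0 P0).
Qed.

(** Conjugation by [w0] turns [phi] into an isomorphism that maps simple
    reflections to simple reflections. *)
Lemma phi_order y w : We D e y -> We D e w ->
  (le_e D e y w <-> le_W' D w0 lambda (phi y) (phi w)).
Proof.
rewrite (WeE D e_gt0) /le_e /le_W' /le_W (We_simpleE D e_gt0).
rewrite (W_of_simpleE q_gt0 (fin_integral_Cminus lam_rat) phi_period) => Gy Gw.
pose psi u := conj (phi u).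
apply: (@bruhat_transport _ _ _ _ psi) => //.
- have psi_simple c : lsimple D false c ->
      exists2 c', lsimple D false c' & psi (tV c) = tH c'.
    move=> Sc; rewrite /psi phi_simple //; exact: (w0_conj_simple q_gt0 hw0 Sc).
  have psi_affine : psi (tV (sroot D None)) = tH (sroot D None).
    by rewrite /psi phi_affine; apply: (w0_affine q_gt0 hw0).
  have SN : lsimple D true (sroot D None) by exists None.
  have Sfin c : lsimple D true c -> lsimple D false c \/ c = sroot D None.
    by move=> [[i|] _ ->]; [left; exists (Some i)|right].
  apply/seteqP; split=> [_ [_ [c Sc <-] <-]|_ [c Sc <-]].
    case: (Sfin _ Sc) => [/psi_simple [c' Sc' ->]|->].
      by exists c' => //; apply: lsimple_affine Sc'.
    by rewrite psi_affine; exists (sroot D None).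
  case: (Sfin _ Sc) => [Sc0|->]; last first.
    by exists (tV (sroot D None)) => //; exists (sroot D None).
  have [c' Sc' cE] := w0_conj_simple q_gt0 hw0 Sc0.
  exists (tV c'); first by exists c' => //; apply: lsimple_affine Sc'.
  by rewrite /psi phi_simple // -cE -/(conj (tH c)) conjK.
- by rewrite /psi phi_id; apply: w0_invol.
- by move=> u v Gu Gv; rewrite /psi phi_comp // conj_comp.
- move=> u v Gu Gv E; apply: phi_inj => //.
  by rewrite -(conjK (phi u)) -/(psi u) E conjK.
Qed.

End Phi.
End Comparison.

Theorem theorem9p7 (R : realType) (r : nat) (D : root_datum R r)
    (w0 : hdual R r -> hdual R r) (hw0 : is_w0 D w0)
    (l : nat) (hl : (0 < l)%N)
    (lambda0 : hdual R r) (hlambda0 : Cminus_rat D lambda0)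
    (hlevel : - (lev lambda0 + real_complex R (dcox D)) = l%:R / 2)
    (phi : ('rV[R]_r -> 'rV[R]_r) -> (hdual R r -> hdual R r))
    (hphi : is_phi D l lambda0 phi) :
  [/\ forall y w, We D (e_of l) y -> We D (e_of l) w ->
        (le_e D (e_of l) y w <-> le_W' D w0 lambda0 (phi y) (phi w)),
      forall lambda, dominant D lambda -> alcove D (e_of l) lambda ->
        forall y w,
          minimal_in (le_e D (e_of l))
            [set z | We D (e_of l) z /\ z lambda = y lambda] y ->
          minimal_in (le_e D (e_of l))
            [set z | We D (e_of l) z /\ z lambda = w lambda] w ->
          dominant D (y lambda) -> dominant D (w lambda) ->
          (le_e D (e_of l) y w <-> up_e D (e_of l) (y lambda) (w lambda)) &
      forall lambda mu nu, Cminus_rat D lambda ->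
        dot_orbit D lambda mu -> dot_orbit D lambda nu ->
        forall y w, senders D lambda mu y -> senders D lambda nu w ->
          let y' := conj_by w0 y in
          let w' := conj_by w0 w in
          let min' kappa :=
            minimal_in (le_W' D w0 lambda) (conj_by w0 @` senders D lambda kappa) in
          let min kappa :=
            minimal_in (le_W D lambda) (senders D lambda kappa) in
          [/\ min' mu y' <-> min mu y,
              min' nu w' <-> min nu w &
              min' mu y' -> min' nu w' ->
                (le_W' D w0 lambda y' w' <-> up_h D mu nu) /\
                (le_W D lambda y w <-> up_h D mu nu)]].
Proof.
split.
- exact: (phi_order hw0 hl hlambda0 hlevel hphi).
- move=> lambda dom alc y w [[Wy _] _] [[Ww _] _] dy dw.
  exact: (dominant_alcove_order (e_gt0 hl) dom alc).
- move=> lambda mu nu lam_rat _ _ y w [Wy <-] [Ww <-] y' w' min' min.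
  have [q q0 period] := Cminus_rat_period lam_rat.
  have Iq := fin_integral_Cminus lam_rat; have [[_ anti] _ _] := lam_rat.
  split; try exact: (minimal_conj hw0).
  move=> /(minimal_conj hw0) miny _.
  have main := antidominant_order q0 Iq period anti Wy Ww miny.
  by split=> //; apply: iff_trans main; apply: le_W'_conj.
Qed.
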